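(* There is a universal constant $C$ such that the following holds. Let $G$ be an $N\times N$ GUE matrix scaled to have entries of unit variance, and let $A$ be an arbitrary $N\times N$ complex matrix (not necessarily Hermitian or normal), deterministic or random and independent of $G$. Then for any $\delta\ge0$, $$\mathbb{P}\left(\sigma_N(G+A)\le\delta\right)\le C\,N^2\,\delta^{1/8}.$$
   Context: $\sigma_N(M)$ denotes the smallest singular value of an $N\times N$ matrix $M$. The scaled GUE matrix $G$ is Hermitian, with independent entries on and above the diagonal: the diagonal entries $G_{ii}$ are standard real Gaussians, and for $i<j$ the entries $G_{ij}$ are complex Gaussians whose real and imaginary parts are independent centered real Gaussians of variance $\frac12$. *)

(* Defs.v *)
From HB Require Import structures.
From mathcomp Require Import all_boot all_order all_algebra.
From mathcomp Require Import spectral sesquilinear complex.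
From mathcomp Require Import all_classical all_reals all_analysis.

Set Implicit Arguments.
Unset Strict Implicit.
Unset Printing Implicit Defensive.

Import Order.TTheory GRing.Theory Num.Theory.
Import numFieldNormedType.Exports.

Local Open Scope classical_set_scope.
Local Open Scope ring_scope.
Local Open Scope complex_scope.
Local Open Scope sesquilinear_scope.

(* [spectral_diag] lists the eigenvalues of a normal matrix with multiplicity;
   those of M^* M are nonnegative reals, so taking [Re] loses nothing. *)
Definition singular_values (R : realType) (N : nat) (M : 'M[R[i]]_N) : seq R :=
  sort >=%R
    [seq Num.sqrt (complex.Re (spectral_diag (M ^t* *m M) 0 i))
    | i <- enum 'I_N].

(* Meaningful for N > 0 only (it is 0 for the empty matrix). *)
Definition smallest_singular_value (R : realType) (N : nat)
    (M : 'M[R[i]]_N) : R :=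
  last 0 (singular_values M).

Section RandomMatrices.
Context {R : realType} {d : measure_display} {T : measurableType d}.
Variable P : probability T R.

Definition has_law (X : T -> R) (mu : set R -> \bar R) : Prop :=
  measurable_fun setT X /\
  forall B : set R, measurable B -> P (X @^-1` B) = mu B.

(* The Borel sigma-algebra of the complex plane is that of R * R, so
   sigma(Z) is generated by the real and imaginary parts of Z. *)
Definition sigma_complex (Z : T -> R[i]) : set_system T :=
  g_sigma_preimageU (fun w => complex.Re (Z w)) (fun w => complex.Im (Z w)).

Definition sigma_mx (N : nat) (X : T -> 'M[R[i]]_N) : set_system T :=
  <<s \bigcup_(ij : 'I_N * 'I_N) sigma_complex (fun w => X w ij.1 ij.2) >>.

Definition random_mx (N : nat) (X : T -> 'M[R[i]]_N) : Prop :=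
  forall i j, measurable_fun setT (fun w => complex.Re (X w i j)) /\
              measurable_fun setT (fun w => complex.Im (X w i j)).

Definition independent2 (S1 S2 : set_system T) : Prop :=
  forall E F, S1 E -> S2 F -> P (E `&` F) = (P E * P F)%E.

Definition mutually_independent (I : finType) (D : {set I})
    (S : I -> set_system T) : Prop :=
  forall (J : {set I}) (E : I -> set T), J \subset D ->
    (forall i, i \in J -> S i (E i)) ->
    P (\bigcap_(i in [set` J]) E i) = (\prod_(i in J) P (E i))%E.

(* [normal_prob m s] takes the standard deviation s, hence the square root. *)
Definition is_scaled_GUE (N : nat) (G : T -> 'M[R[i]]_N) : Prop :=
  [/\ forall w, G w \is hermsymmx,
      forall i, has_law (fun w => complex.Re (G w i i)) (normal_prob 0 1),
      forall i j : 'I_N, (i < j)%N ->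
        [/\ has_law (fun w => complex.Re (G w i j))
                    (normal_prob 0 (Num.sqrt 2^-1)),
            has_law (fun w => complex.Im (G w i j))
                    (normal_prob 0 (Num.sqrt 2^-1)) &
            independent2
              (g_sigma_algebra_preimage (fun w => complex.Re (G w i j)))
              (g_sigma_algebra_preimage (fun w => complex.Im (G w i j)))] &
      mutually_independent
        [set ij : 'I_N * 'I_N | (ij.1 <= ij.2)%N]%SET
        (fun ij => sigma_complex (fun w => G w ij.1 ij.2))].

End RandomMatrices.

(* Main.v *)
Require Import Defs.
From HB Require Import structures.
From mathcomp Require Import all_boot all_order all_algebra complex.
From mathcomp Require Import spectral sesquilinear.
From mathcomp Require Import all_classical all_reals all_analysis.
From mathcomp Require Import measurable_realfun interval_inference.
From mathcomp Require Import ring lra.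

(* Let M = G + A.  For a rank-one Hermitian direction x x^*, the function
   s |-> det (M + s x x^* ) is affine with slope D = det (M + x x^* ) - det M,
   and x^* M^-1 x = D / det M.  If x is e_i, e_i + e_j or e_i + i e_j, then
   x x^* is a linear combination of the directions of the real Gaussians that
   make up G_ii, G_jj, G_ij, so conditionally on all the other entries a shear
   of these Gaussians turns P(|det M| < eta |D|) into the length of an interval
   of s, up to a constant factor.  By polarization, the quadratic forms
   x^* M^-1 x control all the entries of M^-1.  Since sigma_N(M) <= delta forces
   some entry of M^-1 to be large, a union bound over the N^2 directions gives
   P(sigma_N(M) <= delta) <= K N^4 delta; interpolating with the trivial bound
   1 gives the stated exponents. *)

Set Implicit Arguments.
Unset Strict Implicit.
Unset Printing Implicit Defensive.

Import Order.TTheory GRing.Theory Num.Theory.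
Import numFieldNormedType.Exports.

Local Open Scope classical_set_scope.
Local Open Scope ring_scope.
Local Open Scope complex_scope.
Local Open Scope sesquilinear_scope.

(** * Rank-one perturbations and singular values *)

(** The obstacle is that along [x x^*] with x = e_i + w e_j four real Gaussians move together,
    whereas a density bound is at hand in one variable only. G_ii serves as the parameter s of the
    line and the other three are translated by multiples of s; undoing this translation makes their
    law depend on s. The density e^(-s^2/2) of G_ii pays for that: each of three factors e^(-s^2/6)
    replaces one translated Gaussian by a fixed, wider one up to a constant, and Fubini then leaves
    only the Lebesgue measure of a set of s. Working with determinants keeps the event an explicit
    inequality for every matrix; invertibility is used only to pass from a small singular value to a
    bad direction. The eigenvalues come from a chosen diagonalization, so measurability of the
    singular value event is read off the coefficients of a characteristic polynomial. In N^4, one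
    factor N^2 counts directions and the other comes from the threshold eta = 4 N^2 delta. *)

Section RankOne.
Variables (F : comUnitRingType) (n : nat).
Implicit Types (M : 'M[F]_n) (u : 'cV[F]_n) (v : 'rV[F]_n).

(** Schur complement of the corner 1. The border isolates v in a single row, so scaling v changes
    one row only, and this needs no inverse of M. *)
Lemma det_rank1_border M u v :
  \det (M + u *m v) = \det (block_mx M u (- v) 1%:M).
Proof.
have <- : block_mx (M + u *m v) u 0 1%:M *m block_mx 1%:M 0 (- v) 1%:M =
          block_mx M u (- v) 1%:M.
  by rewrite mulmx_block !mulmx1 !mulmx0 !mul1mx mulmxN addrK !add0r.
by rewrite det_mulmx det_ublock det_lblock !det1 !mulr1.
Qed.

Lemma det_rank1_affine M u v (s : F) :
  \det (M + s *: (u *m v)) =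
  \det M + s * (\det (M + u *m v) - \det M).
Proof.
have -> : s *: (u *m v) = u *m (s *: v) by rewrite scalemxAr.
rewrite det_rank1_border.
(* The last row (- s v, 1) is s (- v, 1) + (1 - s) (0, 1). Its zero is written [- 0] so that
   [det_rank1_border] folds both determinants back. *)
rewrite (@determinant_multilinear _ _ _ (block_mx M u (- v) 1%:M)
  (block_mx M u (- 0) 1%:M) (rshift n ord0) s (1 - s)).
- rewrite -!det_rank1_border mulmx0 addr0; ring.
- rewrite /block_mx !rowKd !row_row_mx !scale_row_mx add_row_mx -scalerDl [s + _]addrC subrK scale1r.
  by congr row_mx; apply/rowP=> j; rewrite !mxE; ring.
- apply/matrixP => i j; rewrite mxE [RHS]mxE /block_mx !mxE.
  case: splitP => // k lk; have /eqP H := neq_lift (rshift n ord0) i.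
  by exfalso; apply: H; apply/val_inj; rewrite [RHS]lk (ord1 k).
- apply/matrixP => i j; rewrite mxE [RHS]mxE /block_mx !mxE.
  case: splitP => // k lk; have /eqP H := neq_lift (rshift n ord0) i.
  by exfalso; apply: H; apply/val_inj; rewrite [RHS]lk (ord1 k).
Qed.

Lemma det_rank1 M u v : M \in unitmx ->
  \det (M + u *m v) = \det M * (1 + (v *m invmx M *m u) 0 0).
Proof.
move=> Mu; have -> : M + u *m v = M *m (1%:M + (invmx M *m u) *m v).
  by rewrite mulmxDr mulmx1 !mulmxA mulmxV // mul1mx.
rewrite det_mulmx det_rank1_border; congr (_ * _).
have H : block_mx 1%:M 0 v 1%:M *m block_mx 1%:M (invmx M *m u) (- v) 1%:M =
   block_mx 1%:M (invmx M *m u) 0 (1%:M + v *m (invmx M *m u)).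
  by rewrite mulmx_block !mul0mx !mul1mx !mulmx1 !addr0 subrr addrC.
have := congr1 determinant H.
rewrite det_mulmx det_lblock det_ublock !det1 !mul1r => ->.
by rewrite det_mx11 mxE [1%:M _ _]mxE eqxx mulmxA.
Qed.
End RankOne.

(** * Spectrum of the Gram matrix *)

Section Gram.
Variables (C : numClosedFieldType) (n : nat) (M : 'M[C]_n).
Let H := M ^t* *m M.
Let P := spectralmx H.
Let e := spectral_diag H.

Lemma gram_hermsymmx : H \is hermsymmx.
Proof.
apply/is_hermitianmxP; rewrite expr0 scale1r /H trmx_mul map_mxM.
by rewrite trmxCK.
Qed.

Lemma gram_spectral : P *m H *m P ^t* = diag_mx e.
Proof.
have uP := spectral_unitarymx H.
have /hermitian_normalmx/orthomx_spectralP := gram_hermsymmx.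
rewrite -/P -/e => HE; rewrite HE (invmx_unitary uP) !mulmxA (unitarymxP uP) mul1mx.
by rewrite -mulmxA (unitarymxP uP) mulmx1.
Qed.

Lemma gram_eigenvector (i : 'I_n) : exists v : 'cV[C]_n,
  \sum_k `|v k 0| ^+ 2 = 1 /\ \sum_k `|(M *m v) k 0| ^+ 2 = e 0 i.
Proof.
have sumE m (w : 'cV[C]_m) : \sum_k `|w k 0| ^+ 2 = (w ^t* *m w) 0 0.
  by rewrite mxE; apply: eq_bigr => k _; rewrite !mxE normCK mulrC.
have rowE k l : row k P *m (row l P) ^t* = (k == l)%:R%:M.
  have /unitarymxP/matrixP/(_ k l) := spectral_unitarymx H.
  rewrite -/P => PE; apply/matrixP => a b; rewrite !ord1 -[LHS]/((row k P *m _) 0 0).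
  move: PE; rewrite !mxE mulr1n => <-.
  by apply: eq_bigr => j _; rewrite !mxE.
exists ((row i P) ^t*); rewrite !sumE trmx_mul map_mxM trmxCK rowE eqxx mxE; split => //.
rewrite -mulmxA (mulmxA (M ^t*)) -/H mulmxA.
have := gram_spectral => /matrixP/(_ i i); rewrite [RHS]mxE eqxx mulr1n => <-.
rewrite -row_mul; rewrite !mxE; apply: eq_bigr => j _; by rewrite !mxE.
Qed.

Lemma gram_char_poly (t : C) :
  char_poly (t%:M - H) = \prod_i ('X - (t - e 0 i)%:P).
Proof.
have uP := spectral_unitarymx H.
have PP : P *m P ^t* = 1%:M by apply/unitarymxP.
pose phi := map_mx (@polyC C).
have E : char_poly_mx (t%:M - diag_mx e) =
    phi _ _ P *m char_poly_mx (t%:M - H) *m phi _ _ (P ^t*).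
  rewrite /char_poly_mx mulmxBr mulmxBl -!map_mxM -/phi mulmxBr mulmxBl gram_spectral.
  by rewrite !scalar_mxC -!mulmxA -!map_mxM PP map_mx1 !mulmx1.
have D : \det (phi _ _ P) * \det (phi _ _ (P ^t*)) = 1.
  by rewrite -det_mulmx -map_mxM PP map_mx1 det1.
have -> : char_poly (t%:M - H) = char_poly (t%:M - diag_mx e).
  by rewrite /char_poly E !det_mulmx mulrAC D mul1r.
rewrite char_poly_trig.
  by apply: eq_bigr => i _; rewrite !mxE eqxx !mulr1n.
apply/is_trig_mxP => i j ij; rewrite !mxE -val_eqE /= (ltn_eqF ij) !mulr0n subrr //.
Qed.

Lemma gram_eigenvalue_real i : e 0 i \is Num.real.
Proof. exact/mxOverP/hermitian_spectral_diag_real/gram_hermsymmx. Qed.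

(** The polynomial is the product of the X + (e_i - t). Positive shifts give positive coefficients;
    conversely, an eigenvalue e_i <= t yields the nonnegative root t - e_i, impossible for positive
    coefficients. The coefficients are polynomial in the entries of H, unlike the eigenvalues, and
    this is what makes measurability provable. *)
Lemma gram_eigenvalue_gtP (t : C) : t \is Num.real ->
  (forall i, t < e 0 i) <->
  (forall k : 'I_n.+1, 0 < (char_poly (t%:M - H))`_k).
Proof.
move=> tr; split=> [te k|cp i].
- have : (k <= size (index_enum 'I_n))%N.
    by rewrite [index_enum _]unlock -enumT size_enum_ord -ltnS.
  rewrite gram_char_poly; elim: (index_enum _) (k : nat) => [|a r IHr] {k}[|k] //=.
  + by rewrite big_nil coefC eqxx.
  + rewrite big_cons mulrBl coefB coefXM coefCM /= sub0r -mulNr => _.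
    by rewrite mulr_gt0 ?opprB ?subr_gt0 ?IHr.
  rewrite ltnS big_cons mulrBl coefB coefXM coefCM /= -mulNr opprB => kr.
  apply: ltr_wpDr; last exact: IHr.
  have [kr'|rk] := leqP k.+1 (size r).
    by rewrite mulr_ge0 ?ltW ?subr_gt0 ?IHr.
  rewrite nth_default ?mulr0 //.
  by rewrite (@size_prod_XsubC _ _ r (fun i => t - e 0 i)).
- have er := gram_eigenvalue_real i.
  rewrite real_ltNge //; apply/negP => et.
  have : 0 < (char_poly (t%:M - H)).[t - e 0 i].
    rewrite horner_coef size_char_poly big_ord_recl expr0 mulr1.
    rewrite ltr_pwDl ?cp //.
    apply: sumr_ge0 => k _; rewrite mulr_ge0 ?exprn_ge0 ?subr_ge0 //.
    exact/ltW/cp.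
  by rewrite gram_char_poly horner_prod (bigD1 i) //= !hornerE subrr mul0r ltxx.
Qed.
End Gram.

(** * Test directions and polarization *)

Definition direction {C : numClosedFieldType} {n} (i j : 'I_n) (w : C) : 'cV[C]_n :=
  delta_mx i 0 + w *: delta_mx j 0.

(* For invertible [M] this says [|x^* M^-1 x| > 1 / eta]; when the rank-one
   update does not change the determinant it is false, even for singular [M]. *)
Definition rank1_ill {C : numClosedFieldType} {n} (x : 'cV[C]_n) (eta : C)
    (M : 'M[C]_n) : bool :=
  let D := \det (M + x *m (x ^t* )%R) - \det M in
  `|\det M| < eta * `|D|.

Section Polarization.
Variables (C : numClosedFieldType) (n : nat).

Lemma direction_conj i j (w : C) :
  (direction i j w) ^t* = delta_mx 0 i + w^* *: delta_mx 0 j :> 'rV[C]_n.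
Proof.
apply/matrixP => a b; rewrite !mxE rmorphD rmorphM /= !conjC_nat.
by rewrite (andbC (b == i)) (andbC (b == j)).
Qed.

Let quad (Y : 'M[C]_n) (x : 'cV[C]_n) : C := (x ^t* *m Y *m x) 0 0.

Lemma quad_direction (Y : 'M[C]_n) i j w : quad Y (direction i j w) =
  Y i i + w * Y i j + w^* * Y j i + w^* * w * Y j j.
Proof.
have deltaE a b : delta_mx 0 a *m Y *m delta_mx b 0 = (Y a b)%:M :> 'M[C]_1.
  by rewrite -rowE -colE; apply/matrixP => ? ?; rewrite !ord1 !mxE eqxx.
rewrite /quad direction_conj /direction !mulmxDl !mulmxDr -!scalemxAl -!scalemxAr !deltaE.
rewrite !mxE !eqxx !mulr1n; ring.
Qed.

(** Removing Y_ii and Y_jj from the forms at e_i + e_j and e_i + i e_j leaves Y_ij + Y_ji and i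
    (Y_ij - Y_ji), each at most 3 tau. Half their sum or difference, up to a factor i, is one entry.
    The direction with w = i is what separates Y_ij from Y_ji for a non-Hermitian Y. *)
Lemma polarization_bound (Y : 'M[C]_n) (tau : C) :
  (forall i, `|quad Y (direction i i 0)| <= tau) ->
  (forall i j : 'I_n, (i < j)%N -> `|quad Y (direction i j 1)| <= tau /\
                        `|quad Y (direction i j 'i)| <= tau) ->
  forall i j, `|Y i j| <= 3 * tau.
Proof.
move=> diag off.
have diagY i : `|Y i i| <= tau.
  by have := diag i; rewrite quad_direction conjC0 !mul0r !addr0.
have twoY (i j : 'I_n) : (i < j)%N -> `|Y i j| <= 3 * tau /\ `|Y j i| <= 3 * tau.
  move=> /off; rewrite !quad_direction conjCi conjC1 !mul1r.
  set A := (X in `|X|); set B := (X in _ /\ `|X| <= _) => -[At Bt].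
  have Ct : `|A - Y i i - Y j j| <= 3 * tau.
    have -> : 3 * tau = tau + tau + tau by ring.
    by rewrite (le_trans (ler_normB _ _)) // lerD // (le_trans (ler_normB _ _)) // lerD.
  have Dt : `|'i * (B - Y i i - Y j j)| <= 3 * tau.
    rewrite normrM normCi mul1r.
    have -> : 3 * tau = tau + tau + tau by ring.
    by rewrite (le_trans (ler_normB _ _)) // lerD // (le_trans (ler_normB _ _)) // lerD.
  have ii : 'i * 'i = -1 :> C by rewrite -expr2 sqrCi.
  have E1 : Y i j *+ 2 = (A - Y i i - Y j j) - 'i * (B - Y i i - Y j j).
    have -> : 'i * (B - Y i i - Y j j) = 'i * 'i * Y i j - 'i * 'i * Y j i + (1 + ('i * 'i)) * - ('i * Y j j).
      rewrite /B; ring.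
    rewrite ii /A; ring.
  have E2 : Y j i *+ 2 = (A - Y i i - Y j j) + 'i * (B - Y i i - Y j j).
    have -> : 'i * (B - Y i i - Y j j) = 'i * 'i * Y i j - 'i * 'i * Y j i + (1 + ('i * 'i)) * - ('i * Y j j).
      rewrite /B; ring.
    rewrite ii /A; ring.
  split; rewrite -(@ler_pMn2r _ 2) // -normrMn ?E1 ?E2 mulr2n.
    by rewrite (le_trans (ler_normB _ _)) // lerD.
  by rewrite (le_trans (ler_normD _ _)) // lerD.
move=> i j; case: (ltngtP i j) => [ij|ji|/val_inj ->].
- by case: (twoY _ _ ij).
- by case: (twoY _ _ ji).
- by rewrite (le_trans (diagY _)) // ler_peMl ?ler1n // (le_trans _ (diagY j)).
Qed.

(** Otherwise polarization bounds the entries of the inverse by 3 / eta, so each coordinate of v,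
    recovered from M v, is at most n (3 / eta) delta = 3 / (4 n), and the squares sum to at most 9 /
    (16 n) < 1. The 4 in [eta] beats the 3 of polarization; one n pays for the sum over a row of the
    inverse, the other for the sum over the coordinates of v. *)
Lemma near_kernel_rank1_ill (M : 'M[C]_n) (v : 'cV[C]_n) (delta : C) :
  M \in unitmx -> 0 < delta -> \sum_k `|v k 0| ^+ 2 = 1 ->
  (forall l, `|(M *m v) l 0| <= delta) ->
  let eta := 4 * n%:R ^+ 2 * delta in
  (exists i, rank1_ill (direction i i 0) eta M) \/
  (exists i j : 'I_n, (i < j)%N /\
     (rank1_ill (direction i j 1) eta M \/ rank1_ill (direction i j 'i) eta M)).
Proof.
move=> Mu d0 v1 Mv eta.
have n0 : (0 < n)%N.
  case: (n) v v1 {Mv} => // v; rewrite big_ord0 => /esym/eqP; by rewrite oner_eq0.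
have nC : 0 < n%:R :> C by rewrite ltr0n.
have eta0 : 0 < eta by rewrite !mulr_gt0 ?exprn_gt0 ?ltr0n.
case: (boolP [exists i, rank1_ill (direction i i 0) eta M]) => [/existsP//|]; first by left.
rewrite negb_exists => /forallP noill1.
case: (boolP [exists i : 'I_n, exists j : 'I_n, (i < j)%N &&
  (rank1_ill (direction i j 1) eta M || rank1_ill (direction i j 'i) eta M)]).
  move=> /existsP[i /existsP[j /andP[ij /orP ill]]]; right; exists i, j; split => //.
rewrite negb_exists => /forallP noill2; exfalso.
have detM : 0 < `|\det M| by rewrite normr_gt0 -unitfE -unitmxE.
have quadP x : ~~ rank1_ill x eta M -> `|quad (invmx M) x| <= eta^-1.
  rewrite /rank1_ill /= det_rank1 // mulrDr mulr1 addrAC subrr add0r normrM -/(quad _ _).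
  rewrite -real_leNgt ?realM ?normr_real ?gtr0_real // mulrCA ger_pMr // => h.
  by rewrite -[leRHS]mul1r ler_pdivlMr // mulrC.
have Yt := @polarization_bound (invmx M) eta^-1.
have {}Yt i j : `|invmx M i j| <= 3 / eta.
  apply: Yt => [k|k l kl]; first exact/quadP/noill1.
  have := noill2 k; rewrite negb_exists => /forallP/(_ l).
  by rewrite kl /= negb_or => /andP[? ?]; split; exact: quadP.
have vk k : `|v k 0| <= 3 / 4 / n%:R.
  have -> : v = invmx M *m (M *m v) by rewrite mulKmx.
  rewrite mxE (le_trans (ler_norm_sum _ _ _)) //.
  have -> : 3 / 4 / n%:R = \sum_(l < n) (3 / eta * delta).
    rewrite sumr_const card_ord /eta -[RHS]mulr_natr; field.
    by rewrite !gt_eqF.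
  by apply: ler_sum => l _; rewrite normrM ler_pM.
have : \sum_k `|v k 0| ^+ 2 < 1; last by rewrite v1 ltxx.
apply: (@le_lt_trans _ _ (\sum_(k < n) (3 / 4 / n%:R) ^+ 2)).
  by apply: ler_sum => k _; rewrite lerXn2r ?nnegrE // !mulr_ge0 ?invr_ge0 ?ler0n.
rewrite sumr_const card_ord -[ltLHS]mulr_natr.
have -> : (3 / 4 / n%:R) ^+ 2 * n%:R = 9 / 16 / n%:R :> C by field; rewrite gt_eqF.
rewrite ltr_pdivrMr // mul1r (@lt_le_trans _ _ 1) //.
  by rewrite ltr_pdivrMr ?ltr0n // mul1r ltr_nat.
by rewrite ler1n.
Qed.
End Polarization.

(** * The smallest singular value in terms of the Gram matrix *)

Section Singular.
Variables (R : realType) (n : nat).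
Implicit Types (M : 'M[R[i]]_n) (delta : R).

Lemma last_sort_ge_le (s : seq R) (delta : R) : s != [::] ->
  (last 0 (sort >=%R s) <= delta) = has (fun x => x <= delta) s.
Proof.
move=> s0; rewrite -(eq_has_r (mem_sort >=%R s)).
have : sort >=%R s != [::] by rewrite -size_eq0 size_sort size_eq0.
have : sorted >=%R (sort >=%R s) by apply: sort_sorted => x y; exact: ge_total.
case/lastP: (sort _ s) => // t y; rewrite last_rcons => st _.
apply/idP/hasP => [yd|[x]]; first by exists y => //; rewrite mem_rcons mem_head.
rewrite mem_rcons inE => /orP[/eqP -> //|xt xd].
rewrite (le_trans _ xd) //.
move: st; rewrite -rev_sorted rev_rcons /= => /(order_path_min le_trans)/allP/(_ x).
by rewrite mem_rev; apply.
Qed.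

Lemma smallest_singular_value_le M delta : (0 < n)%N -> 0 <= delta ->
  (smallest_singular_value M <= delta) =
  [exists i, spectral_diag (M ^t* *m M) 0 i <= (delta ^+ 2)%:C].
Proof.
move=> n0 d0; rewrite /smallest_singular_value /singular_values last_sort_ge_le.
  have sqrtE x : (Num.sqrt x <= delta) = (x <= delta ^+ 2).
    by rewrite -{1}(ger0_norm d0) -sqrtr_sqr ler_sqrt ?sqr_ge0.
  have eE k : (complex.Re (spectral_diag (M ^t* *m M) 0 k) <= delta ^+ 2) =
      (spectral_diag (M ^t* *m M) 0 k <= (delta ^+ 2)%:C).
    by rewrite -lecR RRe_real ?gram_eigenvalue_real.
  rewrite has_map; apply/hasP/existsP => [[k _ /=]|[k kd]].
    by rewrite sqrtE eE; exists k.
  by exists k; rewrite ?mem_enum //= sqrtE eE.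
by rewrite -size_eq0 size_map size_enum_ord -lt0n.
Qed.

Lemma smallest_singular_value_near_kernel M delta : (0 < n)%N -> 0 <= delta ->
  smallest_singular_value M <= delta ->
  exists v : 'cV[R[i]]_n, \sum_k `|v k 0| ^+ 2 = 1 /\
    forall l, `|(M *m v) l 0| <= delta%:C.
Proof.
move=> n0 d0; rewrite smallest_singular_value_le // => /existsP[i id].
have [v [v1 vM]] := gram_eigenvector M i; exists v; split=> // l.
rewrite -(@ler_pXn2r _ 2) ?nnegrE ?normr_ge0 ?ler0c //.
have <- : (delta ^+ 2)%:C = delta%:C ^+ 2 by rewrite rmorphXn.
rewrite (le_trans _ id) // -vM.
by rewrite (bigD1 l) //= lerDl sumr_ge0 // => k _; rewrite exprn_ge0.
Qed.

Lemma smallest_singular_value_gtP M delta : (0 < n)%N -> 0 <= delta ->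
  ~~ (smallest_singular_value M <= delta) <->
  forall k : 'I_n.+1, 0 < (char_poly ((delta ^+ 2)%:C%:M - M ^t* *m M))`_k.
Proof.
move=> n0 d0; rewrite -gram_eigenvalue_gtP; last by apply/complex_realP; eexists.
have real_d : (delta ^+ 2)%:C \is Num.real by apply/complex_realP; eexists.
rewrite smallest_singular_value_le // negb_exists; split=> [/forallP h i|h].
  by rewrite real_ltNge ?gram_eigenvalue_real.
by apply/forallP => i; rewrite -real_ltNge ?gram_eigenvalue_real.
Qed.
End Singular.

(** * Measurability of complex-valued functions and matrix events *)

(** Stated for an arbitrary ring S so that it serves both for complex entries and for polynomial
    entries, where [Q] asks for measurability of every coefficient; the latter covers characteristic
    polynomials. *)
Lemma det_closed (T : Type) (S : comNzRingType) (Q : (T -> S) -> Prop) n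
    (A : T -> 'M[S]_n) :
  (forall c, Q (fun=> c)) ->
  (forall f g, Q f -> Q g -> Q (fun w => f w + g w)) ->
  (forall f g, Q f -> Q g -> Q (fun w => f w * g w)) ->
  (forall i j, Q (fun w => A w i j)) -> Q (fun w => \det (A w)).
Proof.
move=> Qc QD QM QA.
have Qsum (I : Type) (r : seq I) (F : I -> T -> S) :
    (forall k, Q (F k)) -> Q (fun w => \sum_(k <- r) F k w).
  move=> QF; elim: r => [|k r IHr].
    by under eq_fun do rewrite big_nil; exact: Qc.
  by under eq_fun do rewrite big_cons; exact: QD.
have Qprod (I : Type) (r : seq I) (F : I -> T -> S) :
    (forall k, Q (F k)) -> Q (fun w => \prod_(k <- r) F k w).
  move=> QF; elim: r => [|k r IHr].
    by under eq_fun do rewrite big_nil; exact: Qc.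
  by under eq_fun do rewrite big_cons; exact: QM.
rewrite /determinant; apply: Qsum => s; apply: QM; first exact: Qc.
exact: Qprod.
Qed.

Section MeasurableComplex.
Context {R : realType} {d} {T : measurableType d}.
Implicit Types f g : T -> R[i].

Definition cmeasurable f :=
  measurable_fun [set: T] (fun w => complex.Re (f w)) /\
  measurable_fun [set: T] (fun w => complex.Im (f w)).

Lemma cmeasurable_cst c : cmeasurable (fun=> c).
Proof. by split. Qed.

Lemma cmeasurableD f g : cmeasurable f -> cmeasurable g ->
  cmeasurable (fun w => f w + g w).
Proof.
move=> [fr fi] [gr gi]; split.
  rewrite (_ : (fun w => _) = (fun w => complex.Re (f w)) \+ (fun w => complex.Re (g w))).
    exact: measurable_funD.
  by apply/funext => w /=; case: (f w) (g w) => [? ?] [? ?].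
rewrite (_ : (fun w => _) = (fun w => complex.Im (f w)) \+ (fun w => complex.Im (g w))).
  exact: measurable_funD.
by apply/funext => w /=; case: (f w) (g w) => [? ?] [? ?].
Qed.

Lemma cmeasurableM f g : cmeasurable f -> cmeasurable g ->
  cmeasurable (fun w => f w * g w).
Proof.
move=> [fr fi] [gr gi]; split.
  rewrite (_ : (fun w => _) =
    ((fun w => complex.Re (f w)) \* (fun w => complex.Re (g w))) \-
    ((fun w => complex.Im (f w)) \* (fun w => complex.Im (g w)))).
    by apply: measurable_funB; exact: measurable_funM.
  by apply/funext => w /=; case: (f w) (g w) => [? ?] [? ?].
rewrite (_ : (fun w => _) =
    ((fun w => complex.Re (f w)) \* (fun w => complex.Im (g w))) \+
    ((fun w => complex.Im (f w)) \* (fun w => complex.Re (g w)))).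
  by apply: measurable_funD; exact: measurable_funM.
by apply/funext => w /=; case: (f w) (g w) => [? ?] [? ?].
Qed.

Lemma cmeasurableB f g : cmeasurable f -> cmeasurable g ->
  cmeasurable (fun w => f w - g w).
Proof.
move=> mf mg; under eq_fun do rewrite -mulN1r.
by apply: cmeasurableD => //; apply: cmeasurableM => //; exact: cmeasurable_cst.
Qed.

Lemma cmeasurable_conj f : cmeasurable f -> cmeasurable (fun w => ((f w)^*)%C).
Proof.
move=> [fr fi]; split.
  rewrite (_ : (fun w => _) = (fun w => complex.Re (f w))) //.
  by apply/funext => w /=; case: (f w).
rewrite (_ : (fun w => _) = \- (fun w => complex.Im (f w))).
  exact: measurable_funN.
by apply/funext => w /=; case: (f w).
Qed.

Lemma cmeasurable_sum (I : Type) (r : seq I) (F : I -> T -> R[i]) :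
  (forall k, cmeasurable (F k)) -> cmeasurable (fun w => \sum_(k <- r) F k w).
Proof.
move=> QF; elim: r => [|k r IHr].
  by under eq_fun do rewrite big_nil; exact: cmeasurable_cst.
by under eq_fun do rewrite big_cons; exact: cmeasurableD.
Qed.

Lemma cmeasurable_det n (A : T -> 'M[R[i]]_n) :
  (forall i j, cmeasurable (fun w => A w i j)) -> cmeasurable (fun w => \det (A w)).
Proof.
apply: det_closed => [||]; [exact: cmeasurable_cst|exact: cmeasurableD|exact: cmeasurableM].
Qed.

Lemma cmeasurable_char_poly n (A : T -> 'M[R[i]]_n) k :
  (forall i j, cmeasurable (fun w => A w i j)) ->
  cmeasurable (fun w => (char_poly (A w))`_k).
Proof.
move=> mA; move: k.
have := @det_closed T {poly R[i]} (fun p => forall k, cmeasurable (fun w => (p w)`_k))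
  n (fun w => char_poly_mx (A w)).
apply=> [c k|p q mp mq k|p q mp mq k|i j k].
- exact: cmeasurable_cst.
- by under eq_fun do rewrite coefD; exact: cmeasurableD.
- under eq_fun do rewrite coefM.
  by apply: cmeasurable_sum => l; exact: cmeasurableM.
- under eq_fun do rewrite !mxE coefB coefC coefMn.
  apply: cmeasurableB; first exact: cmeasurable_cst.
  by case: (k == 0); [exact: mA|exact: cmeasurable_cst].
Qed.

Lemma measurable_sqrt : measurable_fun [set: R] (@Num.sqrt R).
Proof. by apply: continuous_measurable_fun; exact: sqrt_continuous. Qed.

Lemma cmeasurable_norm f : cmeasurable f ->
  measurable_fun [set: T] (fun w => complex.Re `|f w|).
Proof.
move=> [fr fi].
under eq_fun do rewrite normc_def /=.
apply: measurableT_comp; first exact: measurable_sqrt.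
by apply: measurable_funD; exact: measurable_funX.
Qed.

Lemma measurable_rank1_ill n (x : 'cV[R[i]]_n) (eta : R) (A : T -> 'M[R[i]]_n) :
  (forall i j, cmeasurable (fun w => A w i j)) ->
  measurable [set w | rank1_ill x eta%:C (A w)].
Proof.
move=> mA.
pose D w := \det (A w + x *m (x ^t* )) - \det (A w).
have mD : cmeasurable D.
  apply: cmeasurableB; last exact: cmeasurable_det.
  apply: cmeasurable_det => i j; under eq_fun do rewrite mxE.
  by apply: cmeasurableD => //; exact: cmeasurable_cst.
have -> : [set w | rank1_ill x eta%:C (A w)] =
    (fun w => complex.Re `|\det (A w)| < eta * complex.Re `|D w|) @^-1` [set true].
  apply/funext => w; apply/propext; rewrite /mkset /preimage /mkset.
  have normE (z : R[i]) : `|z| = (complex.Re `|z|)%:C by rewrite RRe_real ?normr_real.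
  by rewrite /rank1_ill -/(D w) (normE (\det _)) (normE (D w)) -rmorphM ltcR; split.
rewrite -[X in measurable X]setTI; apply: measurable_fun_ltr => //.
- exact/cmeasurable_norm/cmeasurable_det.
- by apply: measurable_funM => //; exact: cmeasurable_norm.
Qed.

Lemma measurable_det_neq0 n (A : T -> 'M[R[i]]_n) :
  (forall i j, cmeasurable (fun w => A w i j)) ->
  measurable [set w | \det (A w) != 0].
Proof.
move=> /cmeasurable_det/cmeasurable_norm mA.
have -> : [set w | \det (A w) != 0] =
    (fun w => 0 < complex.Re `|\det (A w)|) @^-1` [set true].
  apply/funext => w; apply/propext; rewrite /mkset /preimage /mkset.
  by rewrite -normr_gt0 -[`|_|]RRe_real ?normr_real // ltcR; split.
by rewrite -[X in measurable X]setTI; apply: measurable_fun_ltr.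
Qed.

(** The complement is a finite intersection of events stating that a coefficient of a characteristic
    polynomial is positive, by [smallest_singular_value_gtP]. *)
Lemma measurable_smallest_singular_value_le n (A : T -> 'M[R[i]]_n) (delta : R) :
  (0 < n)%N -> 0 <= delta ->
  (forall i j, cmeasurable (fun w => A w i j)) ->
  measurable [set w | smallest_singular_value (A w) <= delta].
Proof.
move=> n0 d0 mA.
pose c (k : 'I_n.+1) w := (char_poly ((delta ^+ 2)%:C%:M - (A w) ^t* *m A w))`_k.
rewrite -[X in measurable X]setCK; apply: measurableC.
have -> : ~` [set w | smallest_singular_value (A w) <= delta] =
    \bigcap_(k in [set: 'I_n.+1]) [set w | 0 < c k w].
  apply/seteqP; split=> w /=.
    by move=> /negP/(smallest_singular_value_gtP _ n0 d0) h k _; exact: h.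
  move=> h; apply/negP/(smallest_singular_value_gtP _ n0 d0) => k; exact: h.
apply: fin_bigcap_measurable; first exact: finite_finset.
move=> k _.
have [mr mi] : cmeasurable (c k).
  apply: cmeasurable_char_poly => i j; under eq_fun do rewrite mxE [X in _ + X]mxE [X in _ - X]mxE.
  apply: cmeasurableB; first exact: cmeasurable_cst.
  apply: cmeasurable_sum => l; apply: cmeasurableM => //.
  under eq_fun do rewrite !mxE; exact: cmeasurable_conj.
have -> : [set w | 0 < c k w] = (fun w => (complex.Im (c k w) == 0) &&
    (0 < complex.Re (c k w))) @^-1` [set true].
  by apply/funext => w; apply/propext; rewrite /mkset /preimage /mkset ltcE; split.
rewrite -[X in measurable X]setTI; apply: measurable_and => //.
  exact: measurable_fun_eqr.
exact: measurable_fun_ltr.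
Qed.
End MeasurableComplex.

(** * Shears of Gaussian product measures *)

Section Normal.
Context {R : realType}.
Local Notation mu := (@lebesgue_measure R).

(** Uniqueness of densities identifies the Radon-Nikodym derivative of [normal_prob] almost
    everywhere with [normal_pdf]. *)
Lemma integral_normal_prob (m s : R) (f : R -> \bar R) :
  measurable_fun [set: R] f ->
  (\int[normal_prob m s]_x `|f x| < +oo)%E ->
  (\int[normal_prob m s]_x f x = \int[mu]_x (f x * (normal_pdf m s x)%:E))%E.
Proof.
move=> mf finf.
have dom := normal_prob_dominates m s.
rewrite -(Radon_Nikodym_change_of_variables dom)//=; last first.
  by apply/integrableP; split.
apply: ae_eq_integral => //.
- by apply: emeasurable_funM => //; apply: (measurable_int mu).
- apply: emeasurable_funM => //=; apply/measurableT_comp => //=.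
  exact: measurable_normal_pdf.
- apply: ae_eqe_mul2l => /=.
  rewrite Radon_NikodymE//=.
  case: cid => /= h [h1 h2 h3].
  apply: integral_ae_eq => //=.
  + by apply/measurableT_comp =>//; exact: measurable_normal_pdf.
  + by move=> E E01 mE; rewrite -h3.
Qed.

Lemma lebesgue_measure_shift (m : R) (A : set R) : measurable A ->
  pushforward mu ((fun x => x + m) : _ -> measurableTypeR R) A = mu A.
Proof.
move=> mA.
have mc : measurable_fun [set: R] ((fun x : R => x + m) : _ -> measurableTypeR R).
  exact: measurable_funD.
apply/esym/lebesgue_measure_unique => //= _ [[a b]] _ <-.
rewrite /pushforward.
have -> : (fun x => x + m) @^-1` [set` `]a, b]] = `](a - m), (b - m)]%classic.
  by apply/predeqP => x /=; rewrite !in_itv /= ltrBlDr lerBrDr.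
by rewrite !lebesgue_measure_itv/= !lte_fin ltrD2r -!EFinB opprB addrA subrK.
Qed.

Lemma normal_prob_shift (m s c : R) (A : set R) : s != 0 -> measurable A ->
  normal_prob m s ((fun x => x + c) @^-1` A) = normal_prob (m + c) s A.
Proof.
move=> s0 mA; rewrite /normal_prob.
have mc : measurable_fun [set: R] ((fun x : R => x + c) : _ -> measurableTypeR R).
  exact: measurable_funD.
pose tau : R -> measurableTypeR R := fun x => x + c.
transitivity (\int[pushforward mu tau]_(x in A) (normal_pdf (m + c)%R s x)%:E)%E; last first.
  by apply: eq_measure_integral => //= B mB _; exact: lebesgue_measure_shift.
rewrite ge0_integral_pushforward //=.
- apply: eq_integral => x _ /=; rewrite !normal_pdfE // /normal_fun /tau.
  by rewrite opprD addrACA subrr addr0.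
- apply/measurable_funTS/measurableT_comp => //; exact: measurable_normal_pdf.
- by move=> x _; rewrite lee_fin normal_pdf_ge0.
Qed.

(** In the exponents, (x - u c)^2 <= 2 x^2 + 2 u^2, so (x - u c)^2 / 12 <= u^2 / 6 + x^2 / 2. The
    condition 6 <= t^2 gives the 12, and s <= 1 makes the exponent of the original density at least
    x^2 / 2. *)
Lemma normal_pdf_dominated (s t c x : R) : 0 < s <= 1 -> 0 < t ->
  6 <= t ^+ 2 -> `|c| <= 1 -> forall u,
  expR (- (u ^+ 2) / 6) * normal_pdf 0 s x <=
  normal_peak s / normal_peak t * normal_pdf (u * c) t x.
Proof.
move=> /andP[s0 s1] t0 t6 c1 u.
rewrite !normal_pdfE ?gt_eqF //= mulrCA -mulrA ler_pM2l ?normal_peak_gt0 ?gt_eqF //.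
have pt : normal_peak t != 0 by rewrite gt_eqF // normal_peak_gt0 // gt_eqF.
rewrite (mulKf pt) /normal_fun -expRD ler_expR subr0.
rewrite -lerN2 opprD !mulNr !opprK.
have c2 : c ^+ 2 <= 1 by rewrite -real_normK ?num_real // expr_le1.
have -> : t ^+ 2 *+ 2 = 2 * t ^+ 2 by rewrite -mulr_natl.
have -> : s ^+ 2 *+ 2 = 2 * s ^+ 2 by rewrite -mulr_natl.
apply: (@le_trans _ _ ((x - u * c) ^+ 2 / 12)).
  rewrite ler_wpM2l ?sqr_ge0 // lef_pV2 ?posrE ?mulr_gt0 ?exprn_gt0 //.
  by lra.
apply: (@le_trans _ _ (u ^+ 2 / 6 + x ^+ 2 / 2)); last first.
  rewrite lerD2l ler_wpM2l ?sqr_ge0 // lef_pV2 ?posrE ?mulr_gt0 ?exprn_gt0 //.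
  by rewrite ger_pMr // expr_le1 // ltW.
have uc : (u * c) ^+ 2 <= u ^+ 2 by rewrite exprMn ler_piMr ?sqr_ge0.
have := sqr_ge0 (x + u * c); nra.
Qed.

Lemma normal_prob_dominated (s t c : R) : 0 < s <= 1 -> 0 < t ->
  6 <= t ^+ 2 -> `|c| <= 1 -> forall u (A : set R), measurable A ->
  ((expR (- (u ^+ 2) / 6))%:E * normal_prob 0 s A <=
  (normal_peak s / normal_peak t)%:E *
    normal_prob 0 t ((fun x => x + u * c)%R @^-1` A))%E.
Proof.
move=> s01 t0 t6 c1 u A mA.
rewrite normal_prob_shift ?gt_eqF // add0r /normal_prob.
have mpdf m r : measurable_fun A (fun x => (normal_pdf m r x)%:E).
  by apply/measurable_funTS/measurableT_comp => //; exact: measurable_normal_pdf.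
have pdf0 m r x : A x -> (0 <= (normal_pdf m r x)%:E)%E.
  by rewrite lee_fin normal_pdf_ge0.
have peak0 : 0 <= normal_peak s / normal_peak t by rewrite divr_ge0 ?normal_peak_ge0.
rewrite -!ge0_integralZl_EFin ?expR_ge0 //; try exact: mpdf; try exact: pdf0.

apply: ge0_le_integral => //.
- by move=> x _; rewrite -EFinM lee_fin mulr_ge0 ?expR_ge0 ?normal_pdf_ge0.
- by apply: measurable_funeM; exact: mpdf.
- by apply: measurable_funeM; exact: mpdf.
- by move=> x _; rewrite -!EFinM lee_fin normal_pdf_dominated.
Qed.

End Normal.

Section ProductDomination.
Context {R : realType} d1 d2 (Y1 : measurableType d1) (Y2 : measurableType d2).
Variables (m1 n1 : probability Y1 R) (m2 n2 : probability Y2 R).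
Local Open Scope ereal_scope.

(** One coordinate at a time: the second hypothesis is applied on sections under the integral, the
    first after extension from sets to nonnegative functions. The set [A'], where only [t2] acts, is
    the halfway point. *)
Lemma product_measure_dominated (a1 k1 a2 k2 : {nonneg R})
    (t1 : Y1 -> Y1) (t2 : Y2 -> Y2) :
  measurable_fun [set: Y1] t1 -> measurable_fun [set: Y2] t2 ->
  (forall A, measurable A -> a1%:num%:E * m1 A <= k1%:num%:E * n1 (t1 @^-1` A)) ->
  (forall A, measurable A -> a2%:num%:E * m2 A <= k2%:num%:E * n2 (t2 @^-1` A)) ->
  forall A, measurable A ->
    (a1%:num * a2%:num)%:E * (m1 \x m2) A <=
    (k1%:num * k2%:num)%:E * (n1 \x n2) ((fun z => (t1 z.1, t2 z.2)) @^-1` A).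
Proof.
move=> mt1 mt2 h1 h2 A mA; rewrite /product_measure1 /=.
have mid : measurable_fun [set: Y1 * Y2] (fun z => (z.1, t2 z.2)).
  by apply: measurable_fun_pair => //; exact: measurableT_comp.
pose A' := (fun z => (z.1, t2 z.2)) @^-1` A.
have mA' : measurable A' by rewrite -[A']setTI; exact: mid.
have secA' x : xsection A' x = t2 @^-1` (xsection A x).
  by apply/seteqP; split=> y /=; rewrite /xsection /= !inE.
have mg : measurable_fun [set: Y1] (n2 \o xsection A') by exact: measurable_fun_xsection.
have g0 x : 0 <= (n2 \o xsection A') x by [].
have step1 : a2%:num%:E * \int[m1]_x m2 (xsection A x) <=
    k2%:num%:E * \int[m1]_x (n2 \o xsection A') x.
  have mm2 : measurable_fun [set: Y1] (m2 \o xsection A) by exact: measurable_fun_xsection.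
  rewrite -!ge0_integralZl_EFin //.
  apply: ge0_le_integral => //.
  - by move=> x _; rewrite mule_ge0.
  - exact: measurable_funeM.
  - exact: measurable_funeM.
  - by move=> x _ /=; rewrite secA'; apply: h2; exact: measurable_xsection.
pose nu0 := HB.pack_for {measure set Y1 -> \bar R} (pushforward n1 t1).
pose nu : {measure set Y1 -> \bar R} := mscale k1 (nu0 mt1).
have step2 : a1%:num%:E * \int[m1]_x (n2 \o xsection A') x <=
    k1%:num%:E * \int[n1]_x (n2 \o xsection A') (t1 x).
  rewrite -ge0_integral_mscale //.
  rewrite (le_trans (@ge0_le_measure_integral _ _ _ (mscale a1 m1) nu h1 _ _ measurableT g0 mg)) //.
  by rewrite ge0_integral_mscale //= ge0_integral_pushforward.
rewrite !EFinM -muleA.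
apply: (@le_trans _ _ (a1%:num%:E * (k2%:num%:E * \int[m1]_x (n2 \o xsection A') x))).
  exact: lee_wpmul2l.
rewrite muleCA -muleA (muleCA k1%:num%:E); apply: lee_wpmul2l => //.
Qed.
End ProductDomination.

Section ShearAnticoncentration.
Context {R : realType} d (Y : measurableType d).
Variables (nu nu' : probability Y R) (tau : R -> Y -> Y) (K kappa : R).
Hypothesis K0 : 0 <= K.
Hypothesis mtau : measurable_fun [set: R * Y] (fun z => (z.1, tau z.1 z.2)).
Hypothesis nu_dom : forall s (A : set Y), measurable A ->
  ((expR (- (s ^+ 2) / 2))%:E * nu A <= K%:E * nu' (tau s @^-1` A))%E.
Local Open Scope ereal_scope.

(** The left side integrates [nu] of the sections of B against the density of s. That density is
    [normal_peak 1] times exactly the exponential in [nu_dom], so the integrand becomes [nu'] of a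
    sheared section with no weight in s left. As [nu'] is the same for all s, Tonelli exchanges the
    integrals and the hypothesis on lines applies for each y. *)
Lemma shear_anticoncentration (B : set (R * Y)) : measurable B ->
  (forall y, lebesgue_measure [set s | B (s, tau s y)] <= kappa%:E) ->
  (normal_prob (0 : R)%R 1%R \x nu) B <= (normal_peak (1 : R) * K * kappa)%:E.
Proof.
move=> mB Bk; rewrite /product_measure1 /=.
have mg : measurable_fun [set: R] (nu \o xsection B) by exact: measurable_fun_xsection.
pose B' := (fun z => (z.1, tau z.1 z.2)) @^-1` B.
have mB' : measurable B' by rewrite -[B']setTI; exact: mtau.
have secB' x : xsection B' x = tau x @^-1` (xsection B x).
  by apply/seteqP; split=> y /=; rewrite /xsection /= !inE.
have mg' : measurable_fun [set: R] (nu' \o xsection B') by exact: measurable_fun_xsection.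
rewrite (integral_normal_prob mg); last first.
  apply: (@le_lt_trans _ _ (\int[normal_prob (0:R)%R 1%R]_x (cst 1 x))).
    apply: ge0_le_integral => //=.
    - exact: measurableT_comp.
    - by move=> x _; rewrite gee0_abs // probability_le1 //; exact: measurable_xsection.
  by rewrite integral_cst //= mul1e probability_setT ltry.
pose p := normal_peak (1:R).
have p0 : (0 <= p)%R by exact: normal_peak_ge0.
apply: (@le_trans _ _ (\int[lebesgue_measure]_x ((p * K)%:E * (nu' \o xsection B') x))).
  apply: ge0_le_integral => //=.
  - by move=> x _; rewrite mule_ge0 // lee_fin normal_pdf_ge0.
  - apply: emeasurable_funM => //; apply/measurableT_comp => //.
    exact: measurable_normal_pdf.
  - exact: measurable_funeM.
  - move=> x _; rewrite secB' normal_pdfE ?oner_eq0 //= /normal_fun subr0 expr1n.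
    rewrite muleC !EFinM -!muleA; apply: lee_wpmul2l => //.
    by apply: nu_dom; exact: measurable_xsection.
rewrite ge0_integralZl_EFin ?mulr_ge0 // EFinM.
rewrite -EFinM [leRHS]EFinM. apply: lee_wpmul2l; first by rewrite lee_fin mulr_ge0.
have -> : \int[lebesgue_measure]_x (nu' \o xsection B') x =
    \int[nu']_y (lebesgue_measure \o ysection B') y.
  rewrite -indic_fubini_tonelli_FE // -indic_fubini_tonelli_GE //.
  exact: indic_fubini_tonelli.
apply: (@le_trans _ _ (\int[nu']_y (cst kappa%:E y))).
  apply: ge0_le_integral => //=.
  - exact: measurable_fun_ysection.
  - move=> y _; rewrite (_ : ysection B' y = [set s | B (s, tau s y)]) //.
    by apply/seteqP; split=> x /=; rewrite /ysection /= !inE.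
by rewrite integral_cst //= probability_setT mule1.
Qed.
End ShearAnticoncentration.

Section FourGaussians.
Context {R : realType}.

(* [pair_law] is the law of [(G_ii, (G_jj, (Re G_ij, Im G_ij)))] for i < j. *)
Definition pair_block_law : probability _ R :=
  (normal_prob (0 : R) 1 \x
    (normal_prob (0 : R) (Num.sqrt 2^-1) \x normal_prob (0 : R) (Num.sqrt 2^-1)))%E.

Definition pair_law : probability _ R :=
  (normal_prob (0 : R) 1 \x pair_block_law)%E.

(** One peak bounds the density of G_ii; each quotient is the price of widening another coordinate
    to standard deviation 3, whose square 9 exceeds the required 6. *)
Definition pair_const : R :=
  normal_peak (1 : R) * (normal_peak (1 : R) / normal_peak (3 : R) *
   (normal_peak (Num.sqrt 2^-1 : R) / normal_peak (3 : R) *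
    (normal_peak (Num.sqrt 2^-1 : R) / normal_peak (3 : R)))).

Definition shear (v : R * (R * R)) (s : R) (y : R * (R * R)) : R * (R * R) :=
  (y.1 + s * v.1, (y.2.1 + s * v.2.1, y.2.2 + s * v.2.2)).

Lemma measurable_shear v :
  measurable_fun [set: R * (R * (R * R))] (fun z => (z.1, shear v z.1 z.2)).
Proof.
have m1 : measurable_fun [set: R * (R * (R * R))] fst by exact: measurable_fst.
have m21 : measurable_fun [set: R * (R * (R * R))] (fst \o snd) by exact: measurableT_comp.
have m22 : measurable_fun [set: R * (R * (R * R))] (snd \o snd) by exact: measurableT_comp.
have m221 : measurable_fun [set: R * (R * (R * R))] (fst \o (snd \o snd)) by exact: measurableT_comp.
have m222 : measurable_fun [set: R * (R * (R * R))] (snd \o (snd \o snd)) by exact: measurableT_comp.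
have mM c : measurable_fun [set: R * (R * (R * R))] (fun z => z.1 * c) by exact: measurable_funM.
apply: measurable_fun_pair => //; apply: measurable_fun_pair; first exact: measurable_funD.
by apply: measurable_fun_pair; exact: measurable_funD.
Qed.

Lemma pair_law_anticoncentration (v : R * (R * R)) (kappa : R)
    (B : set (R * (R * (R * R)))) :
  [/\ `|v.1| <= 1, `|v.2.1| <= 1 & `|v.2.2| <= 1] ->
  measurable B ->
  (forall y, (lebesgue_measure [set s | B (s, shear v s y)] <= kappa%:E)%E) ->
  (pair_law B <= (pair_const * kappa)%:E)%E.
Proof.
move=> [v1 v21 v22] mB Bk.
have sh : 0 < Num.sqrt (2^-1 : R) <= 1.
  rewrite sqrtr_gt0 invr_gt0 ltr0n /=; rewrite -[leRHS]sqrtr1 ler_sqrt ?ler01 // invf_le1 ?ltr0n //.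
  by rewrite ler1n.
have s1 : 0 < (1 : R) <= 1 by rewrite ltr01 lexx.
have t0 : (0 : R) < 3 by lra.
have t6 : (6 : R) <= 3 ^+ 2 by lra.
have peak0 (s : R) : 0 <= normal_peak s / normal_peak 3.
  by rewrite divr_ge0 ?normal_peak_ge0.
pose c0 : R := normal_peak 1 / normal_peak 3.
pose c1 : R := normal_peak (Num.sqrt 2^-1) / normal_peak 3.
pose nu' : probability _ R :=
  (normal_prob (0 : R) 3 \x (normal_prob (0 : R) 3 \x normal_prob (0 : R) 3))%E.
have K0 : 0 <= c0 * (c1 * c1) by exact: (mulr_ge0 (peak0 _) (mulr_ge0 (peak0 _) (peak0 _))).
suff dom : forall s (A : set (R * (R * R))), measurable A ->
    ((expR (- (s ^+ 2) / 2))%:E * pair_block_law A <=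
     (c0 * (c1 * c1))%:E * nu' (shear v s @^-1` A))%E.
  exact: (@shear_anticoncentration R _ _ pair_block_law nu' (shear v)
    (c0 * (c1 * c1)) kappa K0 (measurable_shear v) dom B mB Bk).
(* The density [expR (- s ^+ 2 / 2)] of the first coordinate is split into three
   factors, one to absorb the shear of each of the other coordinates into a
   Gaussian of standard deviation 3. *)
move=> s A mA.
have e0 : 0 <= expR (- s ^+ 2 / 6) by exact: expR_ge0.
have md (c : R) : measurable_fun [set: R] (fun x : R => x + s * c).
  exact: measurable_funD.
have dom (t c : R) := @normal_prob_dominated R t 3 c.
pose q : probability _ R := (normal_prob (0 : R) (Num.sqrt 2^-1) \x normal_prob (0 : R) (Num.sqrt 2^-1))%E.
pose q' : probability _ R := (normal_prob (0 : R) 3 \x normal_prob (0 : R) 3)%E.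
have e2 : 0 <= expR (- s ^+ 2 / 6) * expR (- s ^+ 2 / 6) by rewrite mulr_ge0.
have K2 : 0 <= c1 * c1 by exact: mulr_ge0 (peak0 _) (peak0 _).
have H : forall C : set (R * R), measurable C ->
    ((expR (- s ^+ 2 / 6) * expR (- s ^+ 2 / 6))%:E * q C <=
     (c1 * c1)%:E * q' ((fun z => (z.1 + s * v.2.1, z.2 + s * v.2.2))%R @^-1` C))%E.
  exact: (@product_measure_dominated R _ _ _ _ (normal_prob 0 (Num.sqrt 2^-1)) (normal_prob 0 3)
  (normal_prob 0 (Num.sqrt 2^-1)) (normal_prob 0 3)
  (NngNum e0) (NngNum (peak0 (Num.sqrt 2^-1))) (NngNum e0) (NngNum (peak0 (Num.sqrt 2^-1))) _ _
  (md v.2.1) (md v.2.2)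
  (dom _ _ sh t0 t6 v21 s) (dom _ _ sh t0 t6 v22 s)).
have md2 : measurable_fun [set: R * R] (fun z : R * R => (z.1 + s * v.2.1, z.2 + s * v.2.2)).
  by apply: measurable_fun_pair; apply: measurable_funD => //; apply: measurableT_comp.
have H2 := @product_measure_dominated R _ _ _ _ (normal_prob 0 1) (normal_prob 0 3) q q'
  (NngNum e0) (NngNum (peak0 1)) (NngNum e2) (NngNum K2) (fun x : R => x + s * v.1)
  (fun z : R * R => (z.1 + s * v.2.1, z.2 + s * v.2.2))
  (md v.1) md2 (dom _ _ s1 t0 t6 v1 s) H A mA.
have -> : expR (- s ^+ 2 / 2) =
    expR (- s ^+ 2 / 6) * (expR (- s ^+ 2 / 6) * expR (- s ^+ 2 / 6)).
  by rewrite -!expRD; congr expR; field.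
exact: H2.
Qed.
End FourGaussians.

(** * Independence and resampling *)

Section IndependentPair.
Context {R : realType} {d d1 d2 : measure_display} {T : measurableType d}.
Context {T1 : measurableType d1} {T2 : measurableType d2}.
Variables (P : probability T R) (m1 : probability T1 R) (m2 : probability T2 R).
Variables (X : T -> T1) (Y : T -> T2) (F : set T).
Hypotheses (mX : measurable_fun [set: T] X) (mY : measurable_fun [set: T] Y).
Hypothesis mF : measurable F.
Local Open Scope ereal_scope.

Lemma independent_pair_law :
  (forall A B, measurable A -> measurable B ->
    P (X @^-1` A `&` (Y @^-1` B `&` F)) = m1 A * (m2 B * P F)) ->
  forall D, measurable D -> P ((fun w => (X w, Y w)) @^-1` D `&` F) = (m1 \x m2) D * P F.
Proof.
move=> indep D mD.
have PF0 : (0 <= fine (P F))%R by exact: fine_ge0.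
have PFE : P F = (fine (P F))%:E by rewrite fineK // fin_num_measure.
pose p := NngNum PF0.
have mXY : measurable_fun [set: T] (fun w => (X w, Y w)) by exact: measurable_fun_pair.
pose nu0 := HB.pack_for {measure set (T1 * T2) -> \bar R} (pushforward (mrestr P mF) (fun w => (X w, Y w))).
pose nu := nu0 mXY.
have sf2 : sigma_finite setT (mscale p m2).
  by apply: fin_num_fun_sigma_finite => //; rewrite ?measure0 // => U mU; rewrite /mscale fin_numM // fin_num_measure.
pose m2' := HB.pack_for {sigma_finite_measure set T2 -> \bar R} (mscale p m2)
  (Measure_isSigmaFinite.Build _ _ _ (mscale p m2) sf2).
have E1 : (m1 \x m2') D = nu D.
  apply: product_measure_unique => // A B mA mB.
  rewrite /nu0 /= /pushforward /mrestr.
  have -> : (fun w => (X w, Y w)) @^-1` (A `*` B) `&` F = X @^-1` A `&` (Y @^-1` B `&` F).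
    by rewrite setIA.
  by rewrite indep // /m2' /= /mscale /= -PFE (muleC (m2 B)).
have E2 : (m1 \x m2') D = mscale p (m1 \x m2) D.
  apply: product_measure_unique => // A B mA mB.
  rewrite -[LHS]/(p%:num%:E * (m1 \x m2) (A `*` B)) product_measure1E //.
  by rewrite muleCA.
by rewrite -[LHS]/(nu D) -E1 E2 -[LHS]/(p%:num%:E * (m1 \x m2) D) /= -PFE muleC.
Qed.
End IndependentPair.

Section PiSystem.
Context {R : realType} {d d1 : measure_display} {T : measurableType d} {T1 : measurableType d1}.
Variables (P : probability T R) (nu : probability T1 R).
Variables (X : T -> T1) (G : set_system T).
Hypotheses (mX : measurable_fun [set: T] X) (mG : G `<=` measurable).
Hypotheses (GI : setI_closed G) (GT : G setT).
Local Open Scope ereal_scope.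
Hypothesis indep : forall A F, measurable A -> G F ->
  P (X @^-1` A `&` F) = nu A * P F.

(** For fixed A both sides are finite measures in F that agree on a generating pi-system containing
    the whole space. *)
Lemma independent_g_sigma A F : measurable A -> <<s G >> F ->
  P (X @^-1` A `&` F) = nu A * P F.
Proof.
move=> mA sF.
have mXA : measurable (X @^-1` A) by rewrite -[_ @^-1` _]setTI; exact: mX.
have n0 : (0 <= fine (nu A))%R by exact: fine_ge0.
have nE : nu A = (fine (nu A))%:E by rewrite fineK // fin_num_measure.
rewrite setIC nE.
have := @g_sigma_algebra_measure_unique _ R _ G mG (fun=> setT) (fun=> GT) _
   (mrestr P mXA) (mscale (NngNum n0) P) GI _ _ F sF.
apply.
- by apply/seteqP; split=> // x _; exists 0%N.
- by move=> B GB; rewrite /= /mrestr /mscale /= setIC indep // -nE.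
- by move=> k; rewrite /= /mrestr; rewrite ltey_eq fin_num_measure // ; exact: measurableI.
Qed.

Lemma conditional_bound (B : set (g_sigma_algebraType G * T1)) (kappa : R) :
  measurable B -> (forall w, nu (xsection B w) <= kappa%:E) ->
  P [set w | B (w, X w)] <= kappa%:E.
Proof.
move=> mB Bk.
have mid : measurable_fun [set: T] (id : T -> g_sigma_algebraType G).
  move=> _ A mA; rewrite setTI; move: A mA.
  by apply: smallest_sub => //; exact: sigma_algebra_measurable.
pose f := HB.pack_for {mfun T >-> g_sigma_algebraType G} (id : T -> g_sigma_algebraType G)
   (isMeasurableFun.Build _ _ _ _ _ mid).
pose P' := distribution P f.
have mW : measurable_fun [set: T] (fun w => ((w : g_sigma_algebraType G), X w)).
  exact: measurable_fun_pair.
pose nu0 := HB.pack_for {measure set (g_sigma_algebraType G * T1) -> \bar R}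
   (pushforward P (fun w => ((w : g_sigma_algebraType G), X w))).
have E : (P' \x nu) B = nu0 mW B.
  apply: product_measure_unique => // A D mA mD.
  rewrite /= /pushforward /P' /distribution /pushforward /=.
  rewrite muleC -independent_g_sigma // setIC //.
rewrite (_ : [set w | B (w, X w)] = (fun w => (w, X w)) @^-1` B) //.
rewrite [leLHS](_ : _ = (P' \x nu) B); last by rewrite E.
apply: (@le_trans _ _ (\int[P']_w (cst kappa%:E w))).
  apply: ge0_le_integral => //=.
  - exact: measurable_fun_xsection.
by rewrite integral_cst //= probability_setT mule1.
Qed.
End PiSystem.

Section BlockIndependence.
Context {R : realType} {d : measure_display} {T : measurableType d} {I : finType}.
Variables (P : probability T R) (D : {set I}) (S : I -> set_system T).
Variables (SA SG : set_system T).
Hypotheses (sS : forall i, sigma_algebra setT (S i)) (sSA : sigma_algebra setT SA).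
Hypotheses (sSG : sigma_algebra setT SG) (S_SG : forall i, i \in D -> S i `<=` SG).
Hypothesis indepS : mutually_independent P D S.
Hypothesis indepA : independent2 P SA SG.

Let sigma_setI (H : set_system T) : sigma_algebra setT H -> setI_closed H.
Proof.
move=> sH; rewrite -(sigma_algebra_id sH).
exact: (@measurableI _ (g_sigma_algebraType H)).
Qed.

Let sigma_setT (H : set_system T) : sigma_algebra setT H -> H setT.
Proof.
move=> sH; rewrite -(sigma_algebra_id sH).
exact: (@measurableT _ (g_sigma_algebraType H)).
Qed.

Let sigma_bigcap (H : set_system T) (J : {set I}) (E : I -> set T) :
  sigma_algebra setT H -> (forall i, i \in J -> H (E i)) ->
  H (\bigcap_(i in [set` J]) E i).
Proof.
move=> sH; rewrite -(sigma_algebra_id sH) => HE.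
by apply: (@fin_bigcap_measurable _ (g_sigma_algebraType H)); first exact: finite_finset.
Qed.

(* A pi-system generating the sigma-algebra of everything but the block [J]. *)
Definition block_pi (J : {set I}) : set_system T :=
  [set F | exists FA E, [/\ SA FA, forall i, i \in D :\: J -> S i (E i) &
     F = FA `&` \bigcap_(i in [set` D :\: J]) E i]].

Lemma block_piT J : block_pi J setT.
Proof.
exists setT, (fun=> setT); split => [|i _|]; try exact: sigma_setT.
by rewrite setTI; apply/seteqP; split.
Qed.

Lemma block_piI J : setI_closed (block_pi J).
Proof.
move=> _ _ [FA [E [hA hE ->]]] [FA' [E' [hA' hE' ->]]].
exists (FA `&` FA'), (fun i => E i `&` E' i); split.
- exact: sigma_setI.
- by move=> i iJ; apply: sigma_setI => //; [exact: hE|exact: hE'].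
- by rewrite bigcapI setIACA.
Qed.

Lemma block_pi_measurable J : SA `<=` measurable ->
  (forall i, i \in D -> S i `<=` measurable) -> block_pi J `<=` measurable.
Proof.
move=> mA mS _ [FA [E [hA hE ->]]]; apply: measurableI; first exact: mA.
apply: fin_bigcap_measurable; first exact: finite_finset.
move=> i /= iJ; apply: (mS i); last exact: hE.
by move: iJ; rewrite inE => /andP[].
Qed.

Lemma block_piA J F : SA F -> block_pi J F.
Proof.
move=> SF; exists F, (fun=> setT); split => // [i _|]; first exact: sigma_setT.
by rewrite [X in _ `&` X](_ : _ = setT) ?setIT //; apply/seteqP; split.
Qed.

Lemma block_piS J i F : i \in D :\: J -> S i F -> block_pi J F.
Proof.
move=> iJ SF; exists setT, (fun j => if j == i then F else setT); split.
- exact: sigma_setT.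
- by move=> j _; case: eqP => [->//|_]; exact: sigma_setT.
- rewrite setTI; apply/seteqP; split=> w /=.
    by move=> Fw j /= _; case: eqP.
  by move=> /(_ i iJ); rewrite eqxx.
Qed.

(** The events on J and those off J are merged into one family over D. Independence from [SA] splits
    off [FA], and mutual independence is then used over D for the left side and over D minus J for P
    F. *)
Lemma block_independence (J : {set I}) (E : I -> set T) F : J \subset D ->
  (forall i, i \in J -> S i (E i)) -> block_pi J F ->
  P (\bigcap_(i in [set` J]) E i `&` F) = (\prod_(i in J) P (E i) * P F)%E.
Proof.
move=> JD SE [FA [E' [SAF SE' FE]]].
pose E2 i := if i \in J then E i else E' i.
have SE2 i : i \in D -> S i (E2 i).
  by rewrite /E2; case: ifPn => iJ iD; [exact: SE|apply: SE'; rewrite inE iJ].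
have PF : P F = (P FA * \prod_(i in D :\: J) P (E' i))%E.
  rewrite FE indepA //; last first.
    apply: sigma_bigcap => // i iJ; apply: (S_SG _ (SE' i iJ)).
    by move: iJ; rewrite inE => /andP[].
  by rewrite indepS // subsetDl.
have -> : \bigcap_(i in [set` J]) E i `&` F = FA `&` \bigcap_(i in [set` D]) E2 i.
  rewrite FE setICA; congr (_ `&` _).
  apply/seteqP; split=> w /=.
    move=> [h1 h2] i /= iD; rewrite /E2; case: ifPn => iJ; first exact: h1.
    by apply: h2; rewrite /= inE iJ.
  move=> h; split=> i /= iJ; have := h i; rewrite /E2 /=.
    by rewrite iJ; apply; exact: (fintype.subsetP JD).
  by move: iJ; rewrite inE => /andP[/negbTE -> iD]; apply.
rewrite indepA //; last first.
  by apply: sigma_bigcap => // i iD; apply: (S_SG iD); exact: SE2.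
rewrite indepS // PF.
rewrite (big_setID J) /= muleCA (_ : D :&: J = J)%SET; last exact/finset.setIidPr.
congr (_ * _)%E; first by apply: eq_bigr => i; rewrite /E2 => ->.
by congr (_ * _)%E; apply: eq_bigr => i; rewrite /E2 inE => /andP[/negbTE ->].
Qed.
End BlockIndependence.

(** * Resampling the entries of the GUE *)

Section Line.
Context {R : realType}.

Lemma cmeasurable_comp d d' (T : measurableType d) (T' : measurableType d')
    (h : T -> T') (f : T' -> R[i]) :
  measurable_fun [set: T] h -> cmeasurable f -> cmeasurable (f \o h).
Proof. by move=> mh [fr fi]; split; [exact: (measurableT_comp fr mh)|exact: (measurableT_comp fi mh)]. Qed.

Lemma cmeasurable_real d (T : measurableType d) (f : T -> R) :
  measurable_fun [set: T] f -> cmeasurable (fun w => (f w)%:C).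
Proof. by move=> mf; split. Qed.

(** Since the determinant is affine along the line, the increment in [rank1_ill] is the same slope c
    at every point. If c = 0 the strict inequality never holds; otherwise division by c confines s
    to within eta of the real number - Re (det M / c). *)
Lemma rank1_ill_line n (M : 'M[R[i]]_n) (x : 'cV[R[i]]_n) (eta : R) : 0 < eta ->
  (lebesgue_measure [set s : R | rank1_ill x eta%:C (M + s%:C *: (x *m (x ^t* )))%R]
    <= (2 * eta)%:E)%E.
Proof.
move=> eta0.
set B := [set s : R | _].
have mB : measurable B.
  apply: measurable_rank1_ill => i j; under eq_fun do rewrite mxE [X in _ + X]mxE.
  apply: cmeasurableD; first exact: cmeasurable_cst.
  apply: cmeasurableM; last exact: cmeasurable_cst.
  exact: cmeasurable_real.
pose c := \det (M + x *m (x ^t* )) - \det M.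
pose f0 := \det M.
have fE (s : R[i]) : \det (M + s *: (x *m (x ^t* ))) = f0 + s * c by exact: det_rank1_affine.
have BE s : B s -> `|f0 + s%:C * c| < eta%:C * `|c|.
  rewrite /B /= /rank1_ill fE.
  rewrite -addrA -{2}[x *m x ^t*]scale1r -scalerDl fE.
  by rewrite (_ : _ - (f0 + _) = c) //; ring.
pose a := - complex.Re (f0 / c).
have sub : B `<=` `]a - eta, a + eta[%classic.
  move=> s /BE.
  have [->|c0] := eqVneq c 0.
    by rewrite normr0 !mulr0 normr_lt0.
  rewrite -ltr_pdivrMr ?normr_gt0 // -normf_div mulrDl mulfK // => h.
  have : `|complex.Re (f0 / c) + s| < eta.
    rewrite -ltcR (le_lt_trans _ h) // (le_trans _ (normc_ge_Re _)) // lecR.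
    by rewrite (_ : complex.Re (f0 / c + s%:C) = complex.Re (f0 / c) + s) //; case: (f0 / c).
  by rewrite /= in_itv /= ltr_norml /a; lra.
apply: (@le_trans _ _ (lebesgue_measure `]a - eta, a + eta[%classic)).
  by apply: le_measure; rewrite ?inE //; exact: measurable_itv.
rewrite lebesgue_measure_itv /= lte_fin; case: ifPn => _.
  by rewrite -EFinB lee_fin; lra.
by rewrite lee_fin mulr_ge0 // ltW.
Qed.
End Line.

Section GUE.
Context {R : realType} {d : measure_display} {T : measurableType d}.
Variables (P : probability T R) (n : nat) (G A : T -> 'M[R[i]]_n).
Hypotheses (hG : is_scaled_GUE P G) (mA : random_mx A).

Let D := [set ij : 'I_n * 'I_n | (ij.1 <= ij.2)%N]%SET.
Let S (p : 'I_n * 'I_n) := sigma_complex (fun w => G w p.1 p.2).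

Lemma gue_conj w i j : G w j i = ((G w i j)^*)%C.
Proof.
have [/(_ w)/is_hermitianmxP/matrixP/(_ j i) hw _ _ _] := hG.
by rewrite hw expr0 scale1r !mxE.
Qed.

Lemma gue_diag_real w i : complex.Im (G w i i) = 0.
Proof.
have := gue_conj w i i; case: (G w i i) => a b /= [] /eqP.
by rewrite -addr_eq0 -mulr2n mulrn_eq0 /= => /eqP.
Qed.

Lemma cmeasurable_gue i j : cmeasurable (fun w => G w i j).
Proof.
have [_ diag off _] := hG.
have lt_meas (k l : 'I_n) : (k < l)%N -> cmeasurable (fun w => G w k l).
  by move=> /off [[mr _] [mi _] _].
case: (ltngtP i j) => [ij|ji|/val_inj <-]; first exact: lt_meas.
  by under eq_fun do rewrite (gue_conj _ j i); apply: cmeasurable_conj; exact: lt_meas.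
split; first by case: (diag i).
by under eq_fun do rewrite gue_diag_real; exact: measurable_cst.
Qed.

Lemma sigma_complex_measurable (Z : T -> R[i]) : cmeasurable Z ->
  sigma_complex Z `<=` measurable.
Proof.
move=> [mr mi]; apply: smallest_sub; first exact: sigma_algebra_measurable.
by move=> _ [] [B mB <-]; [exact: mr|exact: mi].
Qed.

Let sigma_complexS (Z : T -> R[i]) : sigma_algebra setT (sigma_complex Z).
Proof. exact: smallest_sigma_algebra. Qed.

Let sSA : sigma_algebra setT (sigma_mx A).
Proof. exact: smallest_sigma_algebra. Qed.

Lemma sigma_complex_mx (X : T -> 'M[R[i]]_n) i j :
  sigma_complex (fun w => X w i j) `<=` sigma_mx X.
Proof. by move=> B SB; apply: sub_sigma_algebra; exists (i, j). Qed.

Lemma sigma_mx_measurable (X : T -> 'M[R[i]]_n) :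
  (forall i j, cmeasurable (fun w => X w i j)) -> sigma_mx X `<=` measurable.
Proof.
move=> mX; apply: smallest_sub; first exact: sigma_algebra_measurable.
by move=> B [[i j] _]; exact: sigma_complex_measurable.
Qed.

Section Block.
Variable J : {set 'I_n * 'I_n}.

Let pi := block_pi D S (sigma_mx A) J.

Lemma block_pi_cmeasurable (Z : T -> R[i]) : sigma_complex Z `<=` <<s pi >> ->
  cmeasurable (Z : g_sigma_algebraType pi -> R[i]).
Proof.
move=> Zpi; split=> _ B mB; apply: Zpi; apply: sub_sigma_algebra.
  by left; exists B.
by right; exists B.
Qed.

(* What remains of [G + A] when the entries of [G] indexed by [J], and their
   conjugates, are removed. *)
Definition frozen_part (w : T) : 'M[R[i]]_n := \matrix_(i, j)
  (A w i j + if ((i, j) \in J) || ((j, i) \in J) then 0 else G w i j).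

Lemma cmeasurable_frozen_part i j :
  cmeasurable (fun w : g_sigma_algebraType pi => frozen_part w i j).
Proof.
under eq_fun do rewrite mxE.
apply: cmeasurableD.
  apply: block_pi_cmeasurable => B SB; apply: sub_sigma_algebra; apply: (block_piA _ (fun p => sigma_complexS _)).
  exact: (sigma_complex_mx SB).
have Gmeas (k l : 'I_n) : (k, l) \in D :\: J ->
    cmeasurable (fun w : g_sigma_algebraType pi => G w k l).
  move=> kl; apply: block_pi_cmeasurable => B SB; apply: sub_sigma_algebra.
  exact: (block_piS (fun p => sigma_complexS _) sSA kl).
case: (boolP (((i, j) \in J) || ((j, i) \in J))) => [_|]; first exact: cmeasurable_cst.
rewrite negb_or => /andP[ijJ jiJ].
(* Only entries with i <= j are indexed by [D]; one below the diagonal is measurable as the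
   conjugate of its mirror image. *)
case: (leqP i j) => ij; first by apply: Gmeas; rewrite !inE ijJ.
under eq_fun do rewrite (gue_conj _ j i); apply: cmeasurable_conj; apply: Gmeas.
by rewrite !inE jiJ /= ltnW.
Qed.

Context {d1 : measure_display} {T1 : measurableType d1}.
Variables (nu : probability T1 R) (X : T -> T1) (H : T1 -> 'M[R[i]]_n).
Hypothesis mX : measurable_fun [set: T] X.
Hypothesis mH : forall i j, cmeasurable (fun z => H z i j).
Hypothesis HX : forall w i j, H (X w) i j =
  if ((i, j) \in J) || ((j, i) \in J) then G w i j else 0.
Hypothesis indepX : forall B F, measurable B -> pi F ->
  P (X @^-1` B `&` F) = (nu B * P F)%E.

(** G + A splits as [frozen_part], measurable for the data outside the block, plus [H (X w)],
    independent of those data. An estimate uniform in a deterministic M thus transfers to the random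
    matrix. *)
Lemma gue_rank1_ill_le (x : 'cV[R[i]]_n) (eta kappa : R) :
  (forall M, (nu [set z | rank1_ill x eta%:C (M + H z)%R] <= kappa%:E)%E) ->
  (P [set w | rank1_ill x eta%:C (G w + A w)%R] <= kappa%:E)%E.
Proof.
move=> sec.
have piT : pi setT by exact: (block_piT _ (fun p => sigma_complexS _)).
have piI : setI_closed pi by exact: (block_piI (fun p => sigma_complexS _)).
have pim : pi `<=` measurable.
  apply: block_pi_measurable; first exact: sigma_mx_measurable.
  by move=> i _; apply: sigma_complex_measurable; exact: cmeasurable_gue.
pose B := [set z : g_sigma_algebraType pi * T1 |
  rank1_ill x eta%:C (frozen_part z.1 + H z.2)].
have mB : measurable B.
  apply: measurable_rank1_ill => i j; under eq_fun do rewrite mxE.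
  apply: cmeasurableD.
    exact: (cmeasurable_comp (h := fst) measurable_fst (cmeasurable_frozen_part i j)).
  exact: (cmeasurable_comp (h := snd) measurable_snd (mH i j)).
have -> : [set w | rank1_ill x eta%:C (G w + A w)] = [set w | B (w, X w)].
  apply/funext => w; rewrite /B /=; congr (is_true (rank1_ill _ _ _)).
  apply/matrixP => i j; rewrite !mxE HX [LHS]addrC -addrA; congr (_ + _).
  by case: ifP => _; rewrite ?addr0 ?add0r.
apply: (@conditional_bound _ _ _ _ _ P nu X pi mX pim piI piT indepX B kappa mB) => w.
rewrite (_ : xsection B w = [set z | rank1_ill x eta%:C (frozen_part w + H z)]) //.
by apply/seteqP; split=> z; rewrite /xsection /= inE.
Qed.
End Block.
End GUE.

(** * Estimates for diagonal and off-diagonal directions *)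

Lemma normal_prob_le_lebesgue (R : realType) (m s : R) (A : set R) :
  s != 0 -> measurable A ->
  (normal_prob m s A <= (normal_peak s)%:E * lebesgue_measure A)%E.
Proof.
move=> s0 mA; rewrite /normal_prob -integral_cst //.
apply: ge0_le_integral => //.
- by move=> x _; rewrite lee_fin normal_pdf_ge0.
- by apply/measurable_funTS/measurableT_comp => //; exact: measurable_normal_pdf.
- by move=> x _; rewrite lee_fin normal_pdf_ub.
Qed.

Lemma direction_outerE (C : numClosedFieldType) n (i j : 'I_n) (w : C) :
  direction i j w *m (direction i j w) ^t* =
  delta_mx i i + w^* *: delta_mx i j + (w *: delta_mx j i + (w * w^*) *: delta_mx j j).
Proof.
by rewrite direction_conj /direction mulmxDl !mulmxDr -!scalemxAl -!scalemxAr !mul_delta_mx scalerA.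
Qed.

Lemma mule_rot (R : realType) (a b c e : \bar R) :
  (a * (b * (c * e)) = b * (c * (a * e)))%E.
Proof. by rewrite muleCA (muleCA a). Qed.

Section Cases.
Context {R : realType} {d : measure_display} {T : measurableType d}.
Variables (P : probability T R) (n : nat) (G A : T -> 'M[R[i]]_n).
Hypotheses (hG : is_scaled_GUE P G) (mA : random_mx A).
Hypothesis indepA : independent2 P (sigma_mx A) (sigma_mx G).

Let D := [set ij : 'I_n * 'I_n | (ij.1 <= ij.2)%N]%SET.
Let S (p : 'I_n * 'I_n) := sigma_complex (fun w => G w p.1 p.2).

Lemma gue_block_independence (J : {set 'I_n * 'I_n}) (E : 'I_n * 'I_n -> set T) F :
  J \subset D -> (forall p, p \in J -> S p (E p)) ->
  block_pi D S (sigma_mx A) J F ->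
  P (\bigcap_(p in [set` J]) E p `&` F) = (\prod_(p in J) P (E p) * P F)%E.
Proof.
have [_ _ _ indepG] := hG.
apply: (@block_independence _ _ _ _ P D S (sigma_mx A) (sigma_mx G)) => //.
- exact: smallest_sigma_algebra.
- by move=> [i j] _; exact: (@sigma_complex_mx _ _ _ _ G).
Qed.

Lemma gue_diagonal_ill (i : 'I_n) (eta : R) : 0 < eta ->
  (P [set w | rank1_ill (direction i i 0) eta%:C (G w + A w)%R] <=
   (normal_peak (1 : R) * (2 * eta))%:E)%E.
Proof.
move=> eta0; have [_ diag _ _] := hG.
have outer : direction i i (0 : R[i]) *m (direction i i 0) ^t* = delta_mx i i.
  by rewrite direction_outerE conjC0 mul0r !scale0r !addr0.
pose H (z : R) : 'M[R[i]]_n := z%:C *: (direction i i 0 *m (direction i i 0) ^t* ).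
have JD : [set (i, i)]%SET \subset D by rewrite finset.sub1set inE /=.
have [mX lX] := diag i.
have K := @gue_rank1_ill_le _ _ _ P n G A hG mA [set (i, i)]%SET _ _
  (normal_prob (0 : R) 1) (fun w => complex.Re (G w i i)) H _ _ _ _ (direction i i 0) eta
  (normal_peak (1 : R) * (2 * eta)) .
apply: K => //.
- move=> k l; under eq_fun do rewrite mxE.
  apply: cmeasurableM; last exact: cmeasurable_cst.
  exact: cmeasurable_real.
- move=> w k l; rewrite /H outer !mxE !inE !xpair_eqE.
  case: (eqVneq k i) => [->|ki]; case: (eqVneq l i) => [->|li]; rewrite ?mulr0 ?mulr1 //=.
  by have := gue_diag_real hG w i; case: (G w i i) => a b /= ->.
- move=> B F mB piF.
  have := @gue_block_independence [set (i, i)]%SET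
     (fun=> (fun w => complex.Re (G w i i)) @^-1` B) F JD _ piF.
  rewrite big_set1 lX // => <-.
    by congr (P (_ `&` _)); apply/seteqP; split=> w /= h; [move=> p _|apply: (h (i, i)); rewrite /= inE].
  move=> p; rewrite inE => /eqP ->; apply: sub_sigma_algebra; left.
  by exists B; rewrite ?setTI.
move=> M; have mB : measurable [set z : R | rank1_ill (direction i i 0) eta%:C (M + H z)].
  apply: measurable_rank1_ill => k l; under eq_fun do rewrite mxE [X in _ + X]mxE.
  apply: cmeasurableD; first exact: cmeasurable_cst.
  apply: cmeasurableM; last exact: cmeasurable_cst.
  exact: cmeasurable_real.
apply: (le_trans (normal_prob_le_lebesgue _ (oner_neq0 _) mB)).
rewrite EFinM; apply: lee_wpmul2l; first by rewrite lee_fin normal_peak_ge0.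
exact: rank1_ill_line.
Qed.

Lemma cpair_sigma_complex (Z : T -> R[i]) (B : set (R * R)) : measurable B ->
  sigma_complex Z ((fun w => (complex.Re (Z w), complex.Im (Z w))) @^-1` B).
Proof.
move=> mB; rewrite /sigma_complex.
have := @g_sigma_preimageU_comp _ _ R R (R * R)%type fst snd _
  (fun w => (complex.Re (Z w), complex.Im (Z w))).
rewrite /comp /= => ->.
by exists B => //; rewrite setTI.
Qed.

Section OffDiagonal.
Variables (i j : 'I_n).
Hypothesis ij : (i < j)%N.

Let X (w : T) : R * (R * (R * R)) := (complex.Re (G w i i),
  (complex.Re (G w j j), (complex.Re (G w i j), complex.Im (G w i j)))).

Let J := [set (i, i); (j, j); (i, j)]%SET.

Let JD : J \subset D.
Proof.
apply/fintype.subsetP => p; rewrite !inE => /orP[/orP[]|] /eqP -> //=.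
exact: ltnW.
Qed.

(** Mutual independence of the entries treats G_ij as a single complex variable; its two real
    coordinates are separated by their own independence. The nested product law is then assembled
    from the innermost pair outwards. *)
Lemma offdiagonal_law B F : measurable B -> block_pi D S (sigma_mx A) J F ->
  P (X @^-1` B `&` F) = (pair_law B * P F)%E.
Proof.
move=> mB piF; have [_ diag off _] := hG.
have ineqj : i != j by rewrite -val_eqE /= ltn_eqF.
have [mii lii] := diag i; have [mjj ljj] := diag j.
have [[mr lr] [mi li] indRI] := off i j ij.
pose Y w := (complex.Re (G w i j), complex.Im (G w i j)).
have mY : measurable_fun [set: T] Y by exact: measurable_fun_pair.
have mF : measurable F.
  move: F piF; apply: block_pi_measurable.
    exact: sigma_mx_measurable.
  by move=> p _; apply: sigma_complex_measurable; exact: (cmeasurable_gue hG).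
pose q : probability _ R := (normal_prob (0 : R) (Num.sqrt 2^-1) \x
  normal_prob (0 : R) (Num.sqrt 2^-1))%E.
have lY E : measurable E -> P (Y @^-1` E) = q E.
  move=> mE.
  have := @independent_pair_law _ _ _ _ _ _ _ P (normal_prob (0 : R) (Num.sqrt 2^-1))
    (normal_prob (0 : R) (Num.sqrt 2^-1)) (fun w => complex.Re (G w i j))
    (fun w => complex.Im (G w i j)) setT mr mi measurableT _ E mE.
  rewrite setIT probability_setT mule1; apply=> A1 A2 mA1 mA2.
  rewrite setIT mule1 indRI ?lr ?li //.
    by exists A1; rewrite ?setTI.
  by exists A2; rewrite ?setTI.
have block A1 A2 E : measurable A1 -> measurable A2 -> measurable E ->
    P ((fun w => complex.Re (G w i i)) @^-1` A1 `&`
       ((fun w => complex.Re (G w j j)) @^-1` A2 `&` (Y @^-1` E `&` F))) =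
    (normal_prob (0 : R) 1 A1 * (normal_prob (0 : R) 1 A2 * (q E * P F)))%E.
  move=> mA1 mA2 mE.
  pose Ev (p : 'I_n * 'I_n) := if p == (i, i) then (fun w => complex.Re (G w i i)) @^-1` A1
    else if p == (j, j) then (fun w => complex.Re (G w j j)) @^-1` A2
    else Y @^-1` E.
  have SEv p : p \in J -> S p (Ev p).
    rewrite !inE /Ev => /orP[/orP[]|] /eqP ->.
    - rewrite eqxx; apply: sub_sigma_algebra; left; by exists A1; rewrite ?setTI.
    - rewrite eqxx; case: ifP => [/eqP[ji]|_]; first by rewrite ji eqxx in ineqj.
      apply: sub_sigma_algebra; left; by exists A2; rewrite ?setTI.
    - rewrite !xpair_eqE eqxx (negbTE ineqj) eq_sym (negbTE ineqj) /=.
      exact: cpair_sigma_complex.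
  have := gue_block_independence JD SEv piF.
  have nij : (i == j) = false by exact: negbTE.
  have nji : (j == i) = false by rewrite eq_sym.
  rewrite /J finset.setUC big_setU1 /=; last by rewrite !inE !xpair_eqE nij nji eqxx.
  rewrite big_setU1 /=; last by rewrite !inE !xpair_eqE nij.
  rewrite big_set1 /Ev !xpair_eqE !eqxx nij nji /= lii // ljj // lY //.
  move=> H; transitivity (q E * (normal_prob (0:R) 1 A1 * normal_prob (0:R) 1 A2) * P F)%E.
    rewrite -H. congr (P _); apply/seteqP; split=> w /=.
      move=> [h1 [h2 [h3 hF]]]; split => // p _.
      by case: ifP => // _; case: ifP.
    move=> [h hF].
    have := h (i, i); have := h (j, j); have := h (i, j).
    rewrite /= !inE !xpair_eqE !eqxx nij nji /= => /(_ isT) ? /(_ isT) ? /(_ isT) ?.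
    by [].
  by rewrite -!muleA muleCA; congr (_ * _)%E; rewrite muleCA.
pose Z w := (complex.Re (G w j j), Y w).
have mZ : measurable_fun [set: T] Z by exact: measurable_fun_pair.
have pre_meas (f : T -> R) C : measurable_fun [set: T] f -> measurable C ->
    measurable (f @^-1` C).
  by move=> mf mC; rewrite -[X in measurable X]setTI; exact: mf.
have blockZ A1 E : measurable A1 -> measurable E ->
    P ((fun w => complex.Re (G w i i)) @^-1` A1 `&` (Z @^-1` E `&` F)) =
    (normal_prob (0 : R) 1 A1 * (pair_block_law E * P F))%E.
  (* The constraint on G_ii joins the carried event, so the pair (G_jj, G_ij) can be handled with
     G_ii as a spectator. *)
  move=> mA1 mE; pose F1 := (fun w => complex.Re (G w i i)) @^-1` A1 `&` F.
  have mF1 : measurable F1 by apply: measurableI => //; exact: pre_meas.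
  have PF1 : P F1 = (normal_prob (0 : R) 1 A1 * P F)%E.
    have := block A1 setT setT mA1 measurableT measurableT.
    by rewrite !preimage_setT !setTI !probability_setT !mul1e.
  rewrite setICA.
  rewrite (@independent_pair_law _ _ _ _ _ _ _ P (normal_prob (0 : R) 1) q
    (fun w => complex.Re (G w j j)) Y F1 mjj mY mF1 _ E mE).
    by rewrite PF1 muleCA.
  move=> A2 E2 mA2 mE2; rewrite PF1 /F1.
  rewrite [in LHS](setICA (Y @^-1` E2)).
  by rewrite setICA (block _ _ _ mA1 mA2 mE2) mule_rot.
exact: (@independent_pair_law _ _ _ _ _ _ _ P (normal_prob (0 : R) 1) pair_block_law
    (fun w => complex.Re (G w i i)) Z F mii mZ mF blockZ B mB).
Qed.

(** The modulus condition makes both diagonal coefficients of the outer product equal to 1 and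
    bounds Re w and Im w by 1, as the domination by wider Gaussians requires. *)
Lemma gue_offdiagonal_ill (w : R[i]) (eta : R) : 0 < eta -> w * w^* = 1 ->
  (P [set t | rank1_ill (direction i j w) eta%:C (G t + A t)%R] <=
   (pair_const * (2 * eta))%:E)%E.
Proof.
move=> eta0 w1; have [_ diag off _] := hG.
have nij : (i == j) = false by rewrite -val_eqE /= ltn_eqF.
have nji : (j == i) = false by rewrite eq_sym.
have [[mr _] [mi _] _] := off i j ij.
have mX : measurable_fun [set: T] X.
  apply: measurable_fun_pair; first by case: (diag i).
  by apply: measurable_fun_pair; [case: (diag j)|exact: measurable_fun_pair].
pose H (z : R * (R * (R * R))) : 'M[R[i]]_n := \matrix_(k, l)
  (z.1%:C * ((k == i) && (l == i))%:R + z.2.1%:C * ((k == j) && (l == j))%:R +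
    ((z.2.2.1 +i* z.2.2.2) * ((k == i) && (l == j))%:R +
     (z.2.2.1 -i* z.2.2.2) * ((k == j) && (l == i))%:R)).
have HE z k l : H z k l = z.1%:C * ((k == i) && (l == i))%:R +
    z.2.1%:C * ((k == j) && (l == j))%:R +
    ((z.2.2.1 +i* z.2.2.2) * ((k == i) && (l == j))%:R +
     (z.2.2.1 -i* z.2.2.2) * ((k == j) && (l == i))%:R).
  by rewrite mxE.
have mH k l : cmeasurable (fun z => H z k l).
  under eq_fun do rewrite HE.
  have m1 : measurable_fun [set: R * (R * (R * R))] fst by exact: measurable_fst.
  have m21 : measurable_fun [set: R * (R * (R * R))] (fst \o snd) by exact: measurableT_comp.
  have m221 : measurable_fun [set: R * (R * (R * R))] (fst \o (snd \o snd)).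
    by apply: measurableT_comp => //; exact: measurableT_comp.
  have m222 : measurable_fun [set: R * (R * (R * R))] (snd \o (snd \o snd)).
    by apply: measurableT_comp => //; exact: measurableT_comp.
  have mN : measurable_fun [set: R * (R * (R * R))] (fun z => - (snd \o (snd \o snd)) z).
    exact: measurable_funN.
  have m22 : cmeasurable (fun z : R * (R * (R * R)) => z.2.2.1 +i* z.2.2.2) by split.
  have m22' : cmeasurable (fun z : R * (R * (R * R)) => z.2.2.1 -i* z.2.2.2) by split.
  have mc c : cmeasurable (fun _ : R * (R * (R * R)) => c) by exact: cmeasurable_cst.
  apply: cmeasurableD; apply: cmeasurableD; apply: cmeasurableM => //.
have HX t k l : H (X t) k l = if ((k, l) \in J) || ((l, k) \in J) then G t k l else 0.
  have Gji : (complex.Re (G t i j) -i* complex.Im (G t i j)) = G t j i.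
    by rewrite (gue_conj hG t i j); case: (G t i j).
  have Gij : (complex.Re (G t i j) +i* complex.Im (G t i j)) = G t i j.
    by case: (G t i j).
  have Gd m : (complex.Re (G t m m))%:C = G t m m.
    by have := gue_diag_real hG t m; case: (G t m m) => a b /= ->.
  rewrite HE /X /= Gji Gij !Gd !inE !xpair_eqE.
  case: (eqVneq k i) => [->|ki]; case: (eqVneq l i) => [->|li];
  case: (eqVneq k j) => [kj|kj]; case: (eqVneq l j) => [lj|lj];
  rewrite ?kj ?lj ?nij ?nji ?eqxx /= ?mulr0 ?mulr1 ?addr0 ?add0r //.
have [v1 v2] : `|complex.Re w| <= 1 /\ `|complex.Im w| <= 1.
  have := add_Re2_Im2 w; rewrite normCK w1 => /complexI w2.
  by rewrite !ler_norml; split; apply/andP; split; nra.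
apply: (@gue_rank1_ill_le _ _ _ P n G A hG mA J _ _ pair_law X H mX mH HX
  offdiagonal_law (direction i j w) eta) => M.
(* The (i, j) entry of the outer product is the conjugate of w, hence the minus sign. With G_ii = s
   as parameter, [H (s, shear v s y)] is [H (0, y)] plus s times the outer product. *)
apply: (@pair_law_anticoncentration _ (1, (complex.Re w, - complex.Im w))).
- by rewrite /= normr1 normrN.
- apply: measurable_rank1_ill => k l; under eq_fun do rewrite mxE.
  by apply: cmeasurableD => //; exact: cmeasurable_cst.
move=> y.
rewrite (_ : [set s | _] = [set s : R | rank1_ill (direction i j w) eta%:C
  (M + H (0, y) + s%:C *: (direction i j w *m (direction i j w) ^t* ))]).
  exact: rank1_ill_line.
apply/funext => s /=; congr (is_true (rank1_ill _ _ _)).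
have wJ : w^* = complex.Re w -i* complex.Im w by case: (w).
have linC (a b c e : R) : (a + s * c) +i* (b + s * e) = (a +i* b) + s%:C * (c +i* e).
  by apply/eqP; rewrite eq_complex /=; apply/andP; split; apply/eqP; ring.
have linR (a : R) : (a + s * 1)%:C = a%:C + s%:C by rewrite mulr1 rmorphD.
have linN (a b : R) : (a + s * complex.Re w) -i* (b + s * - complex.Im w) =
    (a -i* b) + s%:C * w.
  by apply/eqP; rewrite eq_complex /=; case: (w) => c e /=;
    apply/andP; split; apply/eqP; ring.
have outE k l : (direction i j w *m (direction i j w) ^t* ) k l =
    ((k == i) && (l == i))%:R + (w^*)%C * ((k == i) && (l == j))%:R +
    (w * ((k == j) && (l == i))%:R + ((k == j) && (l == j))%:R).
  by rewrite direction_outerE w1 scale1r !mxE.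
apply/matrixP => k l.
rewrite [LHS]mxE [RHS]mxE [X in _ = X + _]mxE [X in _ = _ + X]mxE outE !HE.
rewrite /shear /= linR linC linN -wJ rmorph0; ring.
Qed.
End OffDiagonal.
End Cases.

(** * Tail bound *)

Lemma finite_subadditive (R : realType) d (T : measurableType d)
    (P : probability T R) (I : Type) (r : seq I) (U : I -> set T) (kappa : R) :
  (forall i, measurable (U i)) -> (forall i, (P (U i) <= kappa%:E)%E) ->
  measurable (\big[setU/set0]_(i <- r) U i) /\
  (P (\big[setU/set0]_(i <- r) U i) <= ((size r)%:R * kappa)%:E)%E.
Proof.
move=> mU PU; elim: r => [|i r [mr Pr]].
  by rewrite big_nil measure0 mul0r.
rewrite big_cons; split; first exact: measurableU.
rewrite (le_trans (measureU2 _ (mU i) mr)) //= -natr1 mulrDl mul1r addrC EFinD.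
exact: leeD.
Qed.

Lemma char_poly_root_det0 (F : fieldType) n (M : 'M[F]_n) (t : F) :
  \det (M + t%:M) = 0 -> root (char_poly (- M)) t.
Proof.
move=> /eqP/det0P[v v0 vM]; rewrite -eigenvalue_root_char.
apply/eigenvalueP; exists v => //.
by move: vM; rewrite mulmxDr mul_mx_scalar mulmxN => /eqP; rewrite addrC addr_eq0 => /eqP ->.
Qed.

(** Singular shifts are roots of one polynomial; each of its finitely many roots equals 1 / (k + 1)
    for at most one k, and m is taken past all of these. *)
Lemma eventually_unit (R : realType) n (M : 'M[R[i]]_n) :
  exists m, forall k, (m <= k)%N -> \det (M + (k.+1%:R^-1)%:C%:M) != 0.
Proof.
have [rs pE] := closed_field_poly_normal (char_poly (- M)).
have : exists m, forall k, (m <= k)%N -> (k.+1%:R^-1 : R)%:C \notin rs.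
  elim: rs {pE} => [|r rs [m IH]]; first by exists 0%N.
  have [[k0 k0r]|nor] := pselect (exists k0, (k0.+1%:R^-1 : R)%:C = r).
    exists (maxn m k0.+1) => k; rewrite geq_max => /andP[mk kk]; rewrite inE negb_or IH // andbT.
    rewrite -k0r; apply/eqP => /complexI /invr_inj /eqP; rewrite eqr_nat eqSS => /eqP kE.
    by move: kk; rewrite kE ltnn.
  exists m => k mk; rewrite inE negb_or IH // andbT; apply/eqP => kr.
  by apply: nor; exists k.
move=> [m mrs]; exists m => k mk; apply/eqP => /char_poly_root_det0.
rewrite pE (monicP (char_poly_monic _)) scale1r root_prod_XsubC.
exact/negP/mrs.
Qed.

Section Shift.
Context {R : realType} {d : measure_display} {T : measurableType d}.
Variables (P : probability T R) (n : nat) (G A : T -> 'M[R[i]]_n).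
Hypotheses (mA : random_mx A) (indepA : independent2 P (sigma_mx A) (sigma_mx G)).
Variable t : R.

Definition shift_mx (w : T) := A w + t%:C%:M.

Lemma random_shift_mx : random_mx shift_mx.
Proof.
move=> i j; suff : cmeasurable (fun w => shift_mx w i j) by [].
under eq_fun do rewrite !mxE.
by apply: cmeasurableD; [exact: mA|exact: cmeasurable_cst].
Qed.

(** A constant translation pulls Borel sets back to Borel sets, so the shifted matrix generates no
    events beyond those of A. *)
Lemma independent_shift_mx : independent2 P (sigma_mx shift_mx) (sigma_mx G).
Proof.
move=> E F SE SF; apply: indepA => //; move: E SE.
have sA : sigma_algebra setT (sigma_mx A) by exact: smallest_sigma_algebra.
apply: smallest_sub => //= B [[i j] _] /=.
move: B; apply: smallest_sub => //.
have mshift c (C : set R) : measurable C -> measurable ((fun x : R => x + c) @^-1` C).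
  move=> mC; rewrite -[X in measurable X]setTI.
  have : measurable_fun [set: R] (fun x : R => x + c) by exact: measurable_funD.
  exact.
move=> _ [] [C mC <-]; apply: sub_sigma_algebra; exists (i, j) => //=;
  apply: sub_sigma_algebra.
  left; exists ((fun x => x + complex.Re (t%:C *+ (i == j))) @^-1` C); first exact: mshift.
  apply/seteqP; split=> w /=; rewrite /shift_mx !mxE;
  by case: (A w i j) => a b; case: (i == j); rewrite ?mulr1n ?mulr0n /=.
right; exists ((fun x => x + complex.Im (t%:C *+ (i == j))) @^-1` C); first exact: mshift.
apply/seteqP; split=> w /=; rewrite /shift_mx !mxE;
by case: (A w i j) => a b; case: (i == j); rewrite ?mulr1n ?mulr0n /=.
Qed.
End Shift.

(** One constant for both kinds of index pair; the 2 accounts for the two directions w = 1 and w = i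
    of an off-diagonal pair. *)
Definition ill_const (R : realType) : R := normal_peak (1 : R) + 2 * pair_const.

Lemma pair_const_ge0 (R : realType) : 0 <= @pair_const R.
Proof. by rewrite /pair_const !mulr_ge0 ?invr_ge0 ?normal_peak_ge0. Qed.

Lemma ill_const_ge0 (R : realType) : 0 <= ill_const R.
Proof. by rewrite addr_ge0 ?normal_peak_ge0 // mulr_ge0 // pair_const_ge0. Qed.

Section Ill.
Context {R : realType} {d : measure_display} {T : measurableType d}.
Variables (P : probability T R) (n : nat) (G A : T -> 'M[R[i]]_n).
Hypotheses (n0 : (0 < n)%N) (hG : is_scaled_GUE P G) (mA : random_mx A).
Hypothesis indepA : independent2 P (sigma_mx A) (sigma_mx G).

Lemma gue_near_kernel_le (E : set T) (delta : R) : measurable E -> 0 < delta ->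
  (forall w, E w -> G w + A w \in unitmx /\ exists v : 'cV[R[i]]_n,
     \sum_k `|v k 0| ^+ 2 = 1 /\
     forall l, `|((G w + A w) *m v) l 0| <= delta%:C) ->
  (P E <= (8 * ill_const R * n%:R ^+ 4 * delta)%:E)%E.
Proof.
move=> mE d0 hE.
pose eta := 4 * n%:R ^+ 2 * delta.
have etaE : eta%:C = 4 * n%:R ^+ 2 * delta%:C :> R[i].
  by rewrite /eta rmorphM rmorphM rmorphXn /= !rmorph_nat.
have eta0 : 0 < eta by rewrite mulr_gt0 // mulr_gt0 // exprn_gt0 // ltr0n.
pose Q x := [set w | rank1_ill x eta%:C (G w + A w)].
have mQ x : measurable (Q x).
  apply: measurable_rank1_ill => i j; under eq_fun do rewrite mxE.
  by apply: cmeasurableD; [exact: (cmeasurable_gue hG)|exact: mA].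
(* Pairs below the diagonal get the empty event, so that all n^2 pairs share one bound and the union
   is indexed by the full square. *)
pose U (p : 'I_n * 'I_n) : set T :=
  if p.1 == p.2 then Q (direction p.1 p.1 0)
  else if (p.1 < p.2)%N then Q (direction p.1 p.2 1) `|` Q (direction p.1 p.2 'i%R)
  else set0.
pose kappa := ill_const R * (2 * eta).
have eta2 : 0 <= 2 * eta by rewrite mulr_ge0 // ltW.
have peak0 : 0 <= normal_peak (1 : R) by exact: normal_peak_ge0.
have pair0 := pair_const_ge0 R.
have mU p : measurable (U p).
  by rewrite /U; case: ifP => // _; case: ifP => // _; exact: measurableU.
have PU p : (P (U p) <= kappa%:E)%E.
  rewrite /U; case: ifP => [_|_].
    rewrite (le_trans (gue_diagonal_ill hG mA indepA _ eta0)) // lee_fin.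
    by rewrite (ler_wpM2r eta2) // lerDl mulr_ge0.
  case: ifP => [ij|_]; last by rewrite measure0 lee_fin mulr_ge0 ?ill_const_ge0.
  rewrite (le_trans (measureU2 _ (mQ _) (mQ _))) //.
  apply: (@le_trans _ _ ((pair_const * (2 * eta))%:E + (pair_const * (2 * eta))%:E)%E).
    apply: leeD; apply: gue_offdiagonal_ill => //.
      by rewrite mul1r conjC1.
    by rewrite -normCK normCi expr1n.
  rewrite -EFinD lee_fin -mulrDl (ler_wpM2r eta2) //.
  rewrite (_ : pair_const + pair_const = 2 * pair_const); first by rewrite lerDr.
  by rewrite mulr_natl mulr2n.
have [mB PB] := finite_subadditive (index_enum ('I_n * 'I_n)%type) mU PU.
apply: (@le_trans _ _ (P (\big[setU/set0]_p U p))).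
  apply: le_measure; rewrite ?inE // => w /hE[uM [v [v1 vM]]].
  have Uin p : U p w -> (\big[setU/set0]_p U p) w.
    by move=> Up; rewrite (bigD1 p) //=; left.
  have d0C : 0 < delta%:C by rewrite ltcR.
  have := near_kernel_rank1_ill uM d0C v1 vM; rewrite -etaE.
  move=> [[i ill]|[i [j [ij ill]]]].
    by apply: (Uin (i, i)); rewrite /U /= eqxx.
  apply: (Uin (i, j)); rewrite /U /= -val_eqE /= (ltn_eqF ij) ij.
  by case: ill; [left|right].
apply: (le_trans PB); rewrite lee_fin.
have -> : size (index_enum ('I_n * 'I_n)%type) = (n * n)%N.
  by rewrite [index_enum _]unlock -enumT -cardT card_prod !card_ord.
rewrite natrM /kappa /eta le_eqVlt; apply/orP; left; apply/eqP; ring.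
Qed.
End Ill.

Section Tail.
Context {R : realType} {d : measure_display} {T : measurableType d}.
Variables (P : probability T R) (n : nat) (G A : T -> 'M[R[i]]_n).
Hypotheses (n0 : (0 < n)%N) (hG : is_scaled_GUE P G) (mA : random_mx A).
Hypothesis indepA : independent2 P (sigma_mx A) (sigma_mx G).

(* Shifting [A] by the scalars [1/(k+1)] makes [G + A] eventually invertible,
   so that singular matrices need no separate estimate. *)
Lemma gue_smallest_singular_value_le (delta : R) : 0 <= delta ->
  (P [set w | (smallest_singular_value (G w + A w) <= delta)%R]
     <= (8 * ill_const R * n%:R ^+ 4 * delta)%:E)%E.
Proof.
move=> d0; set K := 8 * ill_const R * n%:R ^+ 4.
have K0 : 0 <= K by rewrite mulr_ge0 ?exprn_ge0 // mulr_ge0 // ill_const_ge0.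
set S := [set w | _].
have mM i j : cmeasurable (fun w => (G w + A w) i j).
  by under eq_fun do rewrite mxE; apply: cmeasurableD; [exact: (cmeasurable_gue hG)|exact: mA].
have mS : measurable S by exact: measurable_smallest_singular_value_le.
pose t k : R := k.+1%:R^-1.
have t0 k : 0 < t k by rewrite invr_gt0 ltr0n.
pose V k := [set w | \det (G w + A w + (t k)%:C%:M) != 0].
have mV k : measurable (V k).
  apply: measurable_det_neq0 => i j; under eq_fun do rewrite mxE.
  by apply: cmeasurableD => //; exact: cmeasurable_cst.
(* These events increase to S. On [F m] all shifts of index at least m are invertible, so the bound
   for [S] and [V k] holds with k arbitrarily large and the extra [t k] disappears before m tends to
   infinity. *)
pose F m := S `&` \bigcap_(k >= m) V k.
have mF m : measurable (F m).
  by apply: measurableI => //; apply: bigcap_measurableType => k _; exact: mV.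
have FS : \bigcup_m F m = S.
  apply/seteqP; split=> [w [m _ []]//|w Sw].
  by have [m hm] := eventually_unit (G w + A w); exists m => //; split.
have PV k : (P (S `&` V k) <= (K * (delta + t k))%:E)%E.
  apply: (@gue_near_kernel_le _ _ _ P n G (shift_mx A (t k)) n0 hG) => //.
  - exact: random_shift_mx.
  - exact: independent_shift_mx.
  - exact: measurableI.
  - by rewrite ltr_wpDl.
  move=> w [Sw Vw]; rewrite /shift_mx addrA; split; first by rewrite unitmxE unitfE.
  have [v [v1 vM]] := smallest_singular_value_near_kernel n0 d0 Sw.
  exists v; split => // l; rewrite mulmxDl mul_scalar_mx mxE [X in _ + X]mxE rmorphD /=.
  rewrite (le_trans (ler_normD _ _)) // lerD // normrM.
  have tC0 : 0 <= (t k)%:C by rewrite ler0c ltW.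
  rewrite (ger0_norm tC0) ler_piMr //.
  rewrite -(@expr_le1 _ 2) // -v1 (bigD1 l) //= lerDl; apply: sumr_ge0 => m _.
  exact: exprn_ge0.
have PF m : (P (F m) <= (K * delta)%:E)%E.
  apply/lee_addgt0Pr => e e0.
  have [k mk ke] : exists2 k, (m <= k)%N & K * t k <= e.
    pose N := Num.truncn (K / e).
    exists (maxn m N); first exact: leq_maxl.
    rewrite /t ler_pdivrMr ?ltr0n // mulrC -ler_pdivrMr //.
    apply: (@le_trans _ _ N.+1%:R); first by rewrite ltW // truncnS_gt.
    by rewrite ler_nat ltnS leq_maxr.
  apply: (@le_trans _ _ (P (S `&` V k))).
    apply: le_measure; rewrite ?inE //; first exact: measurableI.
    by move=> w [Sw hw]; split => //; exact: hw.
  by rewrite (le_trans (PV k)) // -EFinD lee_fin mulrDr lerD2l.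
rewrite -FS; have cvgF : P \o F @ \oo --> P (\bigcup_m F m).
  apply: nondecreasing_cvg_mu => //; first by rewrite FS.
  move=> m m' mm'; apply/subsetPset => w [Sw hw]; split => // k /= m'k.
  by apply: hw; exact: (leq_trans mm').
rewrite -(cvg_lim _ cvgF) //; apply: lime_le; first by apply/cvg_ex; eexists; exact: cvgF.
by near=> m; exact: PF.
Unshelve. all: by end_near.
Qed.
End Tail.

(** The minimum of 1 and x is at most x^r when r lies in [0, 1]. The case x = 0 is separate because
    the comparison of powers is for 0 < x. *)
Lemma powR_le_interpolation (R : realType) (p x r : R) :
  0 <= x -> 0 <= r <= 1 -> p <= x -> p <= 1 -> p <= x `^ r.
Proof.
move=> x0 /andP[r0 r1] px p1; have [x1|x1] := leP x 1; last first.
  rewrite (le_trans p1) //; have := ler_powR (ltW x1) r0.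
  by rewrite powRr0.
have [xz|xn0] := eqVneq x 0.
  by rewrite (le_trans px) // xz powR_ge0.
by rewrite (le_trans px) // ger1_powR // lt_neqAle eq_sym xn0 x0.
Qed.

Theorem lemmaA1 (R : realType) :
  exists C : R, forall (N : nat) (d : measure_display) (T : measurableType d)
    (P : probability T R) (G A : T -> 'M[R[i]]_N) (delta : R),
    (0 < N)%N ->
    is_scaled_GUE P G ->
    random_mx A ->
    independent2 P (sigma_mx A) (sigma_mx G) ->
    0 <= delta ->
    (P [set w | (smallest_singular_value (G w + A w) <= delta)%R]
       <= (C * N%:R ^+ 2 * delta `^ 8^-1)%:E)%E.
Proof.
pose K := 8 * ill_const R.
have K0 : 0 <= K by rewrite mulr_ge0 // ill_const_ge0.
(* The eighth root distributes over the linear bound in delta, so the constant is the eighth root of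
   K, independent of N. *)
exists (K `^ 8^-1) => N d T P G A delta N0 hG mA indepA d0.
set S := [set w | _].
have mS : measurable S.
  apply: measurable_smallest_singular_value_le => // i j; under eq_fun do rewrite mxE.
  by apply: cmeasurableD; [exact: (cmeasurable_gue hG)|exact: mA].
have PS := gue_smallest_singular_value_le N0 hG mA indepA d0.
have PSE : P S = (fine (P S))%:E by rewrite fineK // fin_num_measure.
have PS1 : fine (P S) <= 1 by rewrite -lee_fin -PSE probability_le1.
have N1 : 1 <= N%:R :> R by rewrite ler1n.
have N2 : 0 <= N%:R ^+ 2 :> R by rewrite exprn_ge0.
(* N^4 is enlarged to N^16 = (N^2)^8, whose eighth root is the stated N^2; this uses N >= 1. *)
have PSK : fine (P S) <= K * (N%:R ^+ 2) ^+ 8 * delta.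
  rewrite -lee_fin -PSE (le_trans PS) // lee_fin ler_wpM2r // ler_wpM2l // -exprM.
  exact: ler_weXn2l.
have N28 : 0 <= (N%:R ^+ 2) ^+ 8 :> R by exact: exprn_ge0.
have x0 : 0 <= K * (N%:R ^+ 2) ^+ 8 by exact: mulr_ge0.
have r01 : 0 <= (8^-1 : R) <= 1 by rewrite invr_ge0 ler0n invf_le1 ?ltr0n // ler1n.
have := powR_le_interpolation (mulr_ge0 x0 d0) r01 PSK PS1.
rewrite (powRM _ x0 d0) (powRM _ K0 N28).
rewrite -(powR_mulrn 8 N2) -powRrM mulfV // powRr1 // => h.
by rewrite PSE lee_fin.
Qed.
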